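(* Let $k$ be a perfect field and $n\ge1$. Let $f_1,\ldots,f_n$ be hypersurfaces of $\mathbb{P}^n_k$ that intersect transversely at a (closed) point $p\in U_\ell$, where $0\le\ell\le n$. Let $J_\ell=\det\left(\frac{\partial f_i^\ell}{\partial(x_j/x_\ell)}\right)_{1\le i\le n,\,j\neq\ell}$ be the Jacobian determinant of the local expressions $f_i^\ell=f_i\circ\tilde\varphi_\ell^{-1}$ with respect to the coordinates of the chart $\tilde\varphi_\ell$. Then $$\deg_p(f_1,\ldots,f_n)=\operatorname{Tr}_{k(p)/k}\langle J_\ell(\tilde\varphi_\ell(p))\rangle$$ in $\operatorname{GW}(k)$, where $\operatorname{Tr}_{k(p)/k}:\operatorname{GW}(k(p))\to\operatorname{GW}(k)$ is the trace on bilinear forms obtained by post-composing with the field trace $k(p)\to k$.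
   Context: $\mathbb{P}^n_k=\operatorname{Proj}k[x_0,\ldots,x_n]$; a hypersurface is the vanishing locus of a nonzero homogeneous polynomial of positive degree, denoted by the same symbol. $k(p)$ is the residue field of $p$. $\operatorname{GW}(k)$ is the group completion of the monoid of isomorphism classes of non-degenerate symmetric bilinear forms over $k$ under direct sum; $\langle a\rangle$ is the class of $(x,y)\mapsto axy$. Transversality: $f_1,\ldots,f_n$ intersect transversely at $p$ if $p$ lies on all of them, each $f_i$ is smooth at $p$, and $\operatorname{codim}(\bigcap_iT_pf_i)=\sum_i\operatorname{codim}T_pf_i$ in $T_p\mathbb{P}^n\cong k(p)^n$. Charts: $U_\ell=\{x_\ell\neq0\}$ has coordinates $\tilde\varphi_\ell:U_\ell\to\mathbb{A}^n$, where $\tilde\varphi_0([p_0:\cdots:p_n])=(\frac{p_1}{p_0},\ldots,\frac{p_n}{p_0})$ and, for $\ell\ge1$, $\tilde\varphi_\ell([p_0:\cdots:p_n])=((-1)^\ell\frac{p_0}{p_\ell},\frac{p_1}{p_\ell},\ldots,\frac{p_{\ell-1}}{p_\ell},\frac{p_{\ell+1}}{p_\ell},\ldots,\frac{p_n}{p_\ell})$. Writing $y_j$ (the paper writes $x_j/x_\ell$), $j\neq\ell$ in increasing order, for the coordinates on $\mathbb{A}^n$, one has $f_i^0=f_i(1,y_1,\ldots,y_n)$ and, for $\ell\ge1$, $f_i^\ell=f_i((-1)^\ell y_0,y_1,\ldots,y_{\ell-1},1,y_{\ell+1},\ldots,y_n)$; the partial derivatives in $J_\ell$ are with respect to the $y_j$.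 Local degree: for a polynomial map $F=(F_1,\ldots,F_n):\mathbb{A}^n_k\to\mathbb{A}^n_k$ and a closed point $q$ isolated in $F^{-1}(0)$, $\deg_qF\in\operatorname{GW}(k)$ is Morel's local $\mathbb{A}^1$-Brouwer degree. It is represented by the Scheja–Storch form: let $Q=\mathcal{O}_{\mathbb{A}^n,q}/(F_1,\ldots,F_n)$, write $F_i\otimes1-1\otimes F_i=\sum_ja_{ij}(y_j\otimes1-1\otimes y_j)$ with $a_{ij}\in k[y]\otimes_kk[y]$, let $\Delta\in Q\otimes_kQ$ be the image of $\det(a_{ij})$, let $\Theta:\operatorname{Hom}_k(Q,k)\to Q$ be the isomorphism corresponding to $\Delta$ under $Q\otimes_kQ\cong\operatorname{Hom}_k(\operatorname{Hom}_k(Q,k),Q)$, and let $\eta=\Theta^{-1}(1)$; the form is $(a,b)\mapsto\eta(ab)$ on $Q$. The local degree of the section $(f_1,\ldots,f_n)$ of $\bigoplus_i\mathcal{O}(\deg f_i)$ at $p\in U_\ell$, computed in the chart $(U_\ell,\tilde\varphi_\ell)$, is $\deg_p(f_1,\ldots,f_n):=\deg_{\tilde\varphi_\ell(p)}(f_1^\ell,\ldots,f_n^\ell)$. *)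

(* Defs.v *)
From HB Require Import structures.
From mathcomp Require Import all_boot all_order all_algebra all_field.
From mathcomp Require Import boolp classical_sets.
From mathcomp Require Import mpoly.

Set Implicit Arguments.
Unset Strict Implicit.
Unset Printing Implicit Defensive.

Import GRing.Theory.

Local Open Scope ring_scope.
Local Open Scope quotient_scope.

Section GroupCompletion.
Variable M : nmodType.
Implicit Types (x y z : M * M) (a b : M).

Definition gc_eqv x y : bool :=
  `[< exists c : M, x.1 + y.2 + c = y.1 + x.2 + c >].

Lemma gc_eqv_refl : reflexive gc_eqv.
Proof. by move=> x; apply/asboolP; exists 0. Qed.

Lemma gc_eqv_sym : ssrbool.symmetric gc_eqv.
Proof.
by move=> x y; apply/asboolP/asboolP => -[c e]; exists c; rewrite e.
Qed.

Lemma gc_eqv_trans : transitive gc_eqv.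
Proof.
move=> y x z /asboolP[c exy] /asboolP[d eyz]; apply/asboolP.
exists (y.1 + y.2 + c + d).
transitivity ((x.1 + y.2 + c) + (y.1 + z.2 + d)).
  by rewrite !addrA [LHS](ACl (1*4*5*3*2*6)%AC).
rewrite exy eyz !addrA [LHS](ACl (4*2*1*5*3*6)%AC).
by [].
Qed.

Canonical gc_equiv := EquivRel gc_eqv gc_eqv_refl gc_eqv_sym gc_eqv_trans.

Definition group_completion := {eq_quot gc_eqv}.
Local Notation G := group_completion.

HB.instance Definition _ := Choice.on G.
HB.instance Definition _ : EqQuotient _ gc_eqv G := EqQuotient.on G.

Definition gc_add_pair x y := (x.1 + y.1, x.2 + y.2).
Definition gc_opp_pair x := (x.2, x.1).

Definition gc_zero : G := lift_cst G (0 : M, 0 : M).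
Definition gc_add := lift_op2 G gc_add_pair.
Definition gc_opp := lift_op1 G gc_opp_pair.

Canonical pi_gc_zero_morph := PiConst gc_zero.

Lemma gc_pi_eqP x y :
  reflect (exists c, x.1 + y.2 + c = y.1 + x.2 + c) (\pi_G x == \pi_G y).
Proof. by rewrite eqmodE; exact: asboolP. Qed.

Lemma gc_reprP x :
  exists c, (repr (\pi_G x)).1 + x.2 + c = x.1 + (repr (\pi_G x)).2 + c.
Proof. by apply/gc_pi_eqP; rewrite reprK. Qed.

Lemma pi_gc_opp : {morph \pi_G : x / gc_opp_pair x >-> gc_opp x}.
Proof.
move=> x; unlock gc_opp; apply/eqP/gc_pi_eqP => /=.
have [c e] := gc_reprP x; exists c.
by rewrite (addrC x.2) e (addrC x.1).
Qed.
Canonical pi_gc_opp_morph := PiMorph1 pi_gc_opp.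

Lemma pi_gc_add : {morph \pi_G : x y / gc_add_pair x y >-> gc_add x y}.
Proof.
move=> x y; unlock gc_add; apply/eqP/gc_pi_eqP => /=.
have [c ex] := gc_reprP x; have [d ey] := gc_reprP y; exists (c + d).
set X := repr _ in ex *; set Y := repr _ in ey *.
transitivity ((x.1 + X.2 + c) + (y.1 + Y.2 + d)).
  by rewrite !addrA [LHS](ACl (1*3*5*2*4*6)%AC).
by rewrite -ex -ey !addrA [LHS](ACl (1*4*2*5*3*6)%AC).
Qed.
Canonical pi_gc_add_morph := PiMorph2 pi_gc_add.

Lemma gc_addA : associative gc_add.
Proof.
by elim/quotW=> x; elim/quotW=> y; elim/quotW=> z;
  rewrite !piE /gc_add_pair /= !addrA.
Qed.

Lemma gc_addC : commutative gc_add.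
Proof.
by elim/quotW=> x; elim/quotW=> y; rewrite !piE /gc_add_pair (addrC x.1) (addrC x.2).
Qed.

Lemma gc_add0 : left_id gc_zero gc_add.
Proof.
by elim/quotW=> x; rewrite !piE /gc_add_pair /= !add0r -surjective_pairing.
Qed.

Lemma gc_addN : left_inverse gc_zero gc_opp gc_add.
Proof.
elim/quotW=> x; rewrite !piE; apply/eqP/gc_pi_eqP; exists 0.
by rewrite /= !addr0 add0r addrC.
Qed.

HB.instance Definition _ :=
  GRing.isZmodule.Build G gc_addA gc_addC gc_add0 gc_addN.

Definition gc_inj a : G := \pi_G (a, 0).

Lemma gc_injE a b : \pi_G (a, b) = gc_inj a - gc_inj b.
Proof.
rewrite /gc_inj /GRing.opp /GRing.add /= !piE; apply/eqP/gc_pi_eqP.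
by exists 0; rewrite /= !(addr0, add0r).
Qed.

Lemma gc_inj_eqP a b :
  reflect (exists c, a + c = b + c) (gc_inj a == gc_inj b).
Proof.
by apply: (iffP (gc_pi_eqP _ _)) => -[c /=]; rewrite ?addr0 => e; exists c;
  rewrite /= ?addr0.
Qed.

Lemma gc_inj_is_nmod_morphism : nmod_morphism gc_inj.
Proof.
split=> [|a b]; first by rewrite /gc_inj [RHS]/GRing.zero /= !piE.
rewrite /gc_inj [RHS]/GRing.add /= !piE; apply/eqP/gc_pi_eqP.
by exists 0; rewrite /= !addr0.
Qed.
HB.instance Definition _ :=
  GRing.isNmodMorphism.Build M G gc_inj gc_inj_is_nmod_morphism.

Lemma gc_reprE (u : G) : u = gc_inj (repr u).1 - gc_inj (repr u).2.
Proof. by rewrite -gc_injE -surjective_pairing reprK. Qed.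

End GroupCompletion.

Section GroupCompletionMap.
Variables (M N : nmodType) (h : {additive M -> N}).

Definition gc_map (u : group_completion M) : group_completion N :=
  gc_inj (h (repr u).1) - gc_inj (h (repr u).2).

Lemma gc_mapB a b : gc_map (gc_inj a - gc_inj b) = gc_inj (h a) - gc_inj (h b).
Proof.
rewrite -!gc_injE /gc_map -gc_injE; apply/eqP/gc_pi_eqP => /=.
have [c /= e] := gc_reprP (a, b); exists (h c).
by rewrite -!raddfD /= e.
Qed.

Lemma gc_map_inj a : gc_map (gc_inj a) = gc_inj (h a).
Proof. by rewrite -[gc_inj a]subr0 -(raddf0 (@gc_inj M)) gc_mapB !raddf0 addr0. Qed.

Lemma gc_map_is_zmod_morphism : zmod_morphism gc_map.
Proof.
move=> u v; rewrite [u]gc_reprE [v]gc_reprE.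
set a := (repr u).1; set b := (repr u).2.
set c := (repr v).1; set d := (repr v).2.
have -> : gc_inj a - gc_inj b - (gc_inj c - gc_inj d)
        = gc_inj (a + d) - gc_inj (b + c).
  by rewrite !(raddfD (@gc_inj M)) opprB opprD !addrA [LHS](ACl (1*3*2*4)%AC).
rewrite !gc_mapB !(raddfD h) !(raddfD (@gc_inj N)) opprB opprD !addrA.
by rewrite [RHS](ACl (1*3*2*4)%AC).
Qed.
HB.instance Definition _ :=
  GRing.isZmodMorphism.Build _ _ gc_map gc_map_is_zmod_morphism.

End GroupCompletionMap.

(* Isomorphism classes of non-degenerate symmetric bilinear forms over k,    *)
(* each class being represented on some 'rV[k]_d: the matrix A stands for    *)
(* the form (u, v) |-> u *m A *m v^T.                                        *)
Section Forms.
Variable k : fieldType.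

Definition nondeg_sym d (A : 'M[k]_d) : bool := (A^T == A) && (A \in unitmx).

Definition sym_form := {d : nat & {A : 'M[k]_d | nondeg_sym A}}.

Definition form_dim (f : sym_form) : nat := tag f.
Definition form_mx (f : sym_form) : 'M[k]_(form_dim f) := val (tagged f).

Definition SymForm d (A : 'M[k]_d) (hA : nondeg_sym A) : sym_form :=
  existT _ d (exist _ A hA).

Lemma form_mxP (f : sym_form) : nondeg_sym (form_mx f).
Proof. exact: valP (tagged f). Qed.

(* u |-> u *m P is a bijective isometry *)
Definition isometric (f g : sym_form) : bool :=
  `[< exists P : 'M[k]_(form_dim f, form_dim g),
        [/\ row_free P, row_full P & P *m form_mx g *m P^T = form_mx f] >].

Lemma isometricI (f g : sym_form) (P : 'M[k]_(form_dim f, form_dim g)) Q :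
    P *m Q = 1%:M -> Q *m P = 1%:M -> P *m form_mx g *m P^T = form_mx f ->
  isometric f g.
Proof.
move=> PQ QP e; apply/asboolP; exists P; split=> //.
  by apply/row_freeP; exists Q.
by apply/row_fullP; exists Q.
Qed.

Lemma isometricE (f g : sym_form) : isometric f g ->
  exists P : 'M[k]_(form_dim f, form_dim g), exists Q,
    [/\ P *m Q = 1%:M, Q *m P = 1%:M & P *m form_mx g *m P^T = form_mx f].
Proof.
move=> /asboolP[P [/row_freeP[Q PQ] /row_fullP[Q' QP] e]].
exists P, Q; split=> //.
by rewrite -[Q]mul1mx -QP -!mulmxA (mulmxA P) PQ mul1mx QP.
Qed.

Lemma isometric_refl : reflexive isometric.
Proof.
by move=> f; apply: (@isometricI f f 1%:M 1%:M); rewrite ?(trmx1, mulmx1, mul1mx).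
Qed.

Lemma isometric_sym : ssrbool.symmetric isometric.
Proof.
suff H f g : isometric f g -> isometric g f by move=> f g; apply/idP/idP; apply: H.
move=> /isometricE[P [Q [PQ QP e]]]; apply: (isometricI QP PQ).
by rewrite -e !mulmxA QP mul1mx -mulmxA -trmx_mul QP trmx1 mulmx1.
Qed.

Lemma isometric_trans : transitive isometric.
Proof.
move=> g f h /isometricE[P [Q [PQ QP e]]] /isometricE[P' [Q' [PQ' QP' e']]].
apply: (@isometricI f h (P *m P') (Q' *m Q)).
- by rewrite mulmxA -(mulmxA P) PQ' mulmx1.
- by rewrite mulmxA -(mulmxA Q') QP mulmx1.
- by rewrite trmx_mul -e -e' !mulmxA.
Qed.

Canonical isometric_equiv :=
  EquivRel isometric isometric_refl isometric_sym isometric_trans.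

Definition form_class := {eq_quot isometric}.
HB.instance Definition _ := Choice.on form_class.
HB.instance Definition _ : EqQuotient _ isometric form_class :=
  EqQuotient.on form_class.

Lemma isometric_reindex (f g : sym_form)
    (s : 'I_(form_dim f) -> 'I_(form_dim g)) :
    bijective s -> (forall i j, form_mx f i j = form_mx g (s i) (s j)) ->
  isometric f g.
Proof.
case=> t st ts e.
apply: (@isometricI f g (rowsub s 1%:M) (rowsub t 1%:M)).
- by apply/matrixP=> i j; rewrite mul_rowsub_mx mul1mx !mxE st.
- by apply/matrixP=> i j; rewrite mul_rowsub_mx mul1mx !mxE ts.
- apply/matrixP=> i j; rewrite mul_rowsub_mx mul1mx e.
  rewrite mxE (bigD1 (s j)) //= big1 ?addr0 => [|l /negPf nl].
    by rewrite !mxE eqxx mulr1.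
  by rewrite !mxE eq_sym nl mulr0.
Qed.

Lemma form0_subproof : nondeg_sym (0 : 'M[k]_0).
Proof. by rewrite /nondeg_sym trmx0 eqxx unitmxE det_mx00 unitr1. Qed.
Definition form0 := SymForm form0_subproof.

Lemma form_add_subproof (f g : sym_form) :
  nondeg_sym (block_mx (form_mx f) 0 0 (form_mx g)).
Proof.
have /andP[/eqP fs fu] := form_mxP f; have /andP[/eqP gs gu] := form_mxP g.
rewrite /nondeg_sym tr_block_mx !trmx0 fs gs eqxx /=.
by rewrite unitmxE det_ublock unitrM -!unitmxE fu.
Qed.
Definition form_add (f g : sym_form) := SymForm (form_add_subproof f g).

Lemma isometric_dim0 (f g : sym_form) :
  form_dim f = 0%N -> form_dim g = 0%N -> isometric f g.
Proof.
move=> f0 g0; have e : form_dim f = form_dim g by rewrite f0.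
apply: (@isometric_reindex f g (cast_ord e)) => [|i].
  by exists (cast_ord (esym e)) => i; apply: val_inj.
by exfalso; case: i; rewrite f0.
Qed.

Lemma isometric_add f f' g g' :
  isometric f f' -> isometric g g' -> isometric (form_add f g) (form_add f' g').
Proof.
move=> /isometricE[P [Q [PQ QP e]]] /isometricE[P' [Q' [PQ' QP' e']]].
apply: (@isometricI (form_add f g) (form_add f' g')
          (block_mx P 0 0 P') (block_mx Q 0 0 Q')).
- by rewrite mulmx_block !(mulmx0, mul0mx, addr0, add0r) PQ PQ' -scalar_mx_block.
- by rewrite mulmx_block !(mulmx0, mul0mx, addr0, add0r) QP QP' -scalar_mx_block.
- rewrite /form_mx /= tr_block_mx !mulmx_block.
  by rewrite !trmx0 !(mulmx0, mul0mx, addr0, add0r) [_ *m P^T]e [_ *m P'^T]e'.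
Qed.

Definition fc_zero : form_class := lift_cst form_class form0.
Definition fc_add := lift_op2 form_class form_add.
Canonical pi_fc_zero_morph := PiConst fc_zero.

Lemma pi_fc_add : {morph \pi_form_class : f g / form_add f g >-> fc_add f g}.
Proof.
move=> f g; unlock fc_add; apply/eqP; rewrite eqmodE.
by apply: isometric_add; rewrite -(eqmodE isometric_equiv) reprK.
Qed.
Canonical pi_fc_add_morph := PiMorph2 pi_fc_add.

Lemma fc_addA : associative fc_add.
Proof.
elim/quotW=> f; elim/quotW=> g; elim/quotW=> h; rewrite !piE; apply/eqP.
rewrite eqmodE; pose e := addnA (form_dim f) (form_dim g) (form_dim h).
apply: (@isometric_reindex (form_add f (form_add g h))
          (form_add (form_add f g) h) (cast_ord e)) => [|i j].
  by exists (cast_ord (esym e)) => i; apply: val_inj.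
rewrite /form_mx /= -(row_mx0 k) -(col_mx0 k) block_mxA castmxE /= row_mx0 col_mx0.
by congr (block_mx _ _ _ _ _ _); apply: val_inj.
Qed.

Lemma fc_addC : commutative fc_add.
Proof.
elim/quotW=> f; elim/quotW=> g; rewrite !piE; apply/eqP; rewrite eqmodE.
pose sw m n (i : 'I_(m + n)) : 'I_(n + m) :=
  match split i with inl j => rshift n j | inr j => lshift m j end.
have swl m n j : @sw m n (lshift n j) = rshift n j.
  by rewrite /sw; case: split_ordP => i // /eqP; rewrite ?eq_shift // => /eqP ->.
have swr m n j : @sw m n (rshift m j) = lshift m j.
  by rewrite /sw; case: split_ordP => i // /eqP; rewrite ?eq_shift // => /eqP ->.
have swK m n : cancel (@sw m n) (@sw n m).
  by move=> i; case: (split_ordP i) => j ->; rewrite ?(swl, swr).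
apply: (@isometric_reindex (form_add f g) (form_add g f) (@sw _ _)) => [|i j].
  by exists (@sw _ _); apply: swK.
rewrite /form_mx /=.
by case: (split_ordP i) => a ->; case: (split_ordP j) => b ->; rewrite ?(swl, swr)
   ?(block_mxEul, block_mxEur, block_mxEdl, block_mxEdr) ?mxE.
Qed.

Lemma fc_add0 : left_id fc_zero fc_add.
Proof.
elim/quotW=> f; rewrite !piE; apply/eqP; rewrite eqmodE.
apply: (@isometric_reindex (form_add form0 f) f id) => [|i j]; first by exists id.
case: (split_ordP i) => [[]//|a ei]; case: (split_ordP j) => [[]//|b ej].
rewrite ei ej; transitivity (form_mx f a b); first exact: block_mxEdr.
by congr (form_mx f _ _); apply: val_inj.
Qed.

HB.instance Definition _ :=
  GRing.isNmodule.Build form_class fc_addA fc_addC fc_add0.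

Lemma form_class_eqP (f g : sym_form) :
  reflect (isometric f g) (\pi_form_class f == \pi_form_class g).
Proof. by rewrite eqmodE; exact: idP. Qed.

Lemma form_class0 (f : sym_form) : form_dim f = 0%N -> \pi_form_class f = 0.
Proof.
move=> f0; rewrite [RHS]/GRing.zero /= piE; apply/eqP/form_class_eqP.
exact: isometric_dim0.
Qed.

Lemma form_classD (f g : sym_form) :
  \pi_form_class (form_add f g) = \pi_form_class f + \pi_form_class g.
Proof. by rewrite [RHS]/GRing.add /= piE. Qed.

End Forms.

Definition GW (k : fieldType) := group_completion (form_class k).
HB.instance Definition _ (k : fieldType) := GRing.Zmodule.on (GW k).

(* The class of a bilinear form on a finite-dimensional k-space, read off    *)
(* its Gram matrix in any basis: it does not depend on the basis, see        *)
(* [form_class_ofE].  It is 0 by convention when the space has no finite     *)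
(* basis, or when the form is not symmetric or not non-degenerate.           *)
Section FormClassOf.
Variable k : fieldType.

Definition lincomb (V : lmodType k) d (b : 'I_d -> V) (c : 'rV[k]_d) : V :=
  \sum_i c 0 i *: b i.

Definition is_basis (V : lmodType k) d (b : 'I_d -> V) : Prop :=
  bijective (lincomb b).

Definition represents (V : lmodType k) (B : V -> V -> k) (f : sym_form k) :=
  exists2 b : 'I_(form_dim f) -> V, is_basis b &
    forall i j, B (b i) (b j) = form_mx f i j.

Definition form_class_of (V : lmodType k) (B : V -> V -> k) : form_class k :=
  xget 0 [set x | exists2 f, represents B f & x = \pi_(form_class k) f]%classic.

Definition gw_class_of (V : lmodType k) (B : V -> V -> k) : GW k :=
  gc_inj (form_class_of B).

Definition is_bilinear (V : lmodType k) (B : V -> V -> k) : Prop :=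
  (forall u, scalar (B u)) /\ (forall v, scalar (B^~ v)).

Lemma bilinear_lincomb (V : lmodType k) (B : V -> V -> k) d e
    (b : 'I_d -> V) (b' : 'I_e -> V) u v : is_bilinear B ->
  B (lincomb b u) (lincomb b' v)
    = (u *m (\matrix_(i, j) B (b i) (b' j)) *m v^T) 0 0.
Proof.
move=> [Br Bl].
have Bl0 w : B 0 w = 0.
  by have := Bl w (-1) 0 0; rewrite /= scaler0 addr0 mulN1r addNr.
have Br0 w : B w 0 = 0.
  by have := Br w (-1) 0 0; rewrite /= scaler0 addr0 mulN1r addNr.
have suml (I : finType) (F : I -> V) c w :
    B (\sum_i c i *: F i) w = \sum_i c i * B (F i) w.
  elim/big_rec2: _ => [|i y1 y2 _ <-]; first exact: Bl0.
  by rewrite Bl.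
have sumr (I : finType) (F : I -> V) c w :
    B w (\sum_i c i *: F i) = \sum_i c i * B w (F i).
  elim/big_rec2: _ => [|i y1 y2 _ <-]; first exact: Br0.
  by rewrite Br.
rewrite /lincomb sumr mxE; apply: eq_bigr => j _.
rewrite suml !mxE mulrC; congr (_ * _); apply: eq_bigr => i _.
by rewrite mxE.
Qed.

Lemma lincombE (V : lmodType k) d e (b : 'I_d -> V) (P : 'M_(e, d)) c :
  lincomb (fun i => lincomb b (row i P)) c = lincomb b (c *m P).
Proof.
rewrite /lincomb; under eq_bigr do rewrite scaler_sumr.
rewrite exchange_big; apply: eq_bigr => j _ /=.
rewrite mxE scaler_suml; apply: eq_bigr => i _.
by rewrite mxE scalerA.
Qed.

Lemma lincomb_delta (V : lmodType k) d (b : 'I_d -> V) i :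
  lincomb b (delta_mx 0 i) = b i.
Proof.
rewrite /lincomb (bigD1 i) //= big1 ?addr0 ?mxE ?eqxx ?scale1r // => j /negPf nj.
by rewrite mxE nj andbF scale0r.
Qed.

Lemma basis_change (V : lmodType k) d e (b : 'I_d -> V) (b' : 'I_e -> V) :
    is_basis b -> is_basis b' ->
  exists P : 'M[k]_(d, e), exists Q : 'M[k]_(e, d),
    [/\ P *m Q = 1%:M, Q *m P = 1%:M & forall i, b i = lincomb b' (row i P)].
Proof.
move=> bb bb'; have [c bc cb] := bb; have [c' bc' cb'] := bb'.
pose P := \matrix_i c' (b i); pose Q := \matrix_i c (b' i).
have bP i : b i = lincomb b' (row i P) by rewrite rowK cb'.
have bQ i : b' i = lincomb b (row i Q) by rewrite rowK cb.
exists P, Q; split=> //; apply/row_matrixP=> i.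
- rewrite row_mul row1; apply: (can_inj bc).
  rewrite -lincombE lincomb_delta [RHS]bP; apply: eq_bigr => j _.
  by rewrite bQ.
- rewrite row_mul row1; apply: (can_inj bc').
  rewrite -lincombE lincomb_delta [RHS]bQ; apply: eq_bigr => j _.
  by rewrite bP.
Qed.

Lemma represents_isometric (V : lmodType k) (B : V -> V -> k) f g :
  is_bilinear B -> represents B f -> represents B g -> isometric f g.
Proof.
move=> hB [b bb eb] [b' bb' eb'].
have [P [Q [PQ QP e]]] := basis_change bb bb'.
apply: (isometricI PQ QP); apply/matrixP => i j.
rewrite -eb !e bilinear_lincomb // tr_row.
have -> : \matrix_(i, j) B (b' i) (b' j) = form_mx g.
  by apply/matrixP=> a c; rewrite mxE eb'.
rewrite -!row_mul [RHS]mxE [LHS]mxE [RHS]mxE; apply: eq_bigr => l _.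
by rewrite !mxE.
Qed.

Lemma form_class_ofE (V : lmodType k) (B : V -> V -> k) f :
  is_bilinear B -> represents B f -> form_class_of B = \pi_(form_class k) f.
Proof.
move=> hB rf; rewrite /form_class_of; case: xgetP => [x _ [g rg ->]|/(_ _)].
  by apply/eqP/form_class_eqP; apply: represents_isometric rg rf.
by move=> /(_ (\pi_(form_class k) f)) /=; case; exists f.
Qed.

Lemma form_class_of0 (V : lmodType k) (B : V -> V -> k) :
    (forall f, represents B f -> \pi_(form_class k) f = 0) ->
  form_class_of B = 0.
Proof.
by move=> h; rewrite /form_class_of; case: xgetP => // x _ [g /h <-].
Qed.

Lemma represents_iso (V W : lmodType k) (B : V -> V -> k) (C : W -> W -> k)
    (h : V -> W) f :
    linear h -> bijective h -> (forall u v, C (h u) (h v) = B u v) ->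
  represents B f -> represents C f.
Proof.
move=> hl hb hB [b bb eb]; exists (h \o b) => [|i j]; last by rewrite hB.
have e c : lincomb (h \o b) c = h (lincomb b c).
  rewrite /lincomb; have h0 : h 0 = 0.
    by have := hl (-1) 0 0; rewrite scaler0 addr0 scaleN1r addNr.
  elim/big_rec2: _ => [//|i y1 y2 _ ->].
  by rewrite hl.
by apply: (eq_bij (bij_comp hb bb)) => c; rewrite /= e.
Qed.

End FormClassOf.

(* <a> : (x, y) |-> a x y on the one-dimensional space k                     *)
Definition gw_unit (k : fieldType) (a : k) : GW k :=
  @gw_class_of k k^o (fun x y => a * x * y).

Section Trace.
Variables (k : fieldType) (L : fieldExtType k).

(* the trace of the k-linear map y |-> x * y on L                            *)
Definition field_trace (x : L) : k :=
  \sum_i coord (vbasis {:L}) i (x * (vbasis {:L})`_i).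

Lemma field_trace_is_scalar : scalar field_trace.
Proof.
move=> a x y; rewrite /field_trace mulr_sumr -big_split /=.
by apply: eq_bigr => i _; rewrite mulrDl -scalerAl linearP.
Qed.
HB.instance Definition _ :=
  GRing.isLinear.Build k L k *%R field_trace field_trace_is_scalar.

(* Tr o f, as a k-bilinear form on the k-space L^d.                          *)
Definition trace_form (f : sym_form L)
    (u v : {ffun 'I_(form_dim f) -> L}) : k :=
  field_trace ((\row_i u i *m form_mx f *m \col_j v j) 0 0).

Lemma trace_form_bilinear f : is_bilinear (@trace_form f).
Proof.
have rowD c (u v : {ffun 'I_(form_dim f) -> L}) :
    \row_i (c *: u + v) i = c%:A *: \row_i u i + \row_i v i.
  by apply/rowP=> i; rewrite !mxE !ffunE mulr_algl.
have colD c (u v : {ffun 'I_(form_dim f) -> L}) :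
    \col_i (c *: u + v) i = c%:A *: \col_i u i + \col_i v i.
  by apply/colP=> i; rewrite !mxE !ffunE mulr_algl.
split=> w c u v; rewrite /trace_form.
  by rewrite colD mulmxDr -scalemxAr !mxE mulr_algl linearP.
by rewrite rowD !mulmxDl -!scalemxAl !mxE mulr_algl linearP.
Qed.

Lemma vbasisP_is_basis (V : vectType k) :
  @is_basis k V _ (fun i : 'I_(\dim (fullv : {vspace V})) => (vbasis fullv)`_i).
Proof.
set b := vbasis _; exists (fun v => \row_i coord b i v) => [c|v].
  apply/rowP=> i; rewrite mxE /lincomb coord_sum_free //.
  exact: (basis_free (vbasisP _)).
by rewrite [RHS](coord_vbasis (memvf v)); apply: eq_bigr => i _; rewrite mxE.
Qed.

Lemma trace_form_represents f : (exists x, field_trace x != 0) ->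
  exists g, represents (@trace_form f) g.
Proof.
move=> [x tx]; have hB := trace_form_bilinear f.
have /andP[/eqP fs fu] := form_mxP f.
pose D := \dim (fullv : {vspace {ffun 'I_(form_dim f) -> L}}).
pose b (i : 'I_D) := (vbasis (fullv : {vspace {ffun 'I_(form_dim f) -> L}}))`_i.
have bb : is_basis b := vbasisP_is_basis _.
have [c bc cb] := bb.
pose G := \matrix_(i, j) trace_form (b i) (b j).
suff hG : nondeg_sym G by exists (SymForm hG); exists b => // i j; rewrite mxE.
have trB (u v : {ffun 'I_(form_dim f) -> L}) : trace_form u v = trace_form v u.
  rewrite /trace_form; congr field_trace.
  transitivity (((\row_i v i *m form_mx f *m \col_j u j)^T) 0 0); last by rewrite mxE.
  rewrite !trmx_mul fs mulmxA; congr ((_ *m _ *m _) 0 0).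
    by apply/rowP=> i; rewrite !mxE.
  by apply/colP=> i; rewrite !mxE.
apply/andP; split; first by apply/eqP/matrixP=> i j; rewrite !mxE trB.
rewrite -row_free_unit -kermx_eq0; apply/rowV0P => w /sub_kermxP wG.
have Bw (v : {ffun 'I_(form_dim f) -> L}) : trace_form (lincomb b w) v = 0.
  by rewrite -[v]cb bilinear_lincomb // wG mul0mx mxE.
set u := lincomb _ w in Bw.
suff u0 : u = 0.
  by apply: (can_inj bc); rewrite -/u u0 /lincomb big1 // => i _; rewrite mxE scale0r.
apply/eqP/contraT => un0.
have : \row_i u i *m form_mx f != 0.
  apply: contra un0 => /eqP /(congr1 (mulmx^~ (invmx (form_mx f)))).
  rewrite mulmxK // mul0mx => /rowP h; apply/eqP/ffunP => i.
  by have := h i; rewrite !mxE ffunE.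
case/rV0Pn => j; set a := _ 0 j => an0.
have := Bw [ffun l => if l == j then x / a else 0].
rewrite /trace_form mxE (bigD1 j) //= big1 => [|l /negPf nl]; last first.
  by rewrite mxE ffunE nl mulr0.
by rewrite addr0 -/a mxE ffunE eqxx mulrC divfK // => e; rewrite e eqxx in tx.
Qed.

Lemma trace_form_isometric f f' g : isometric f f' ->
  represents (@trace_form f) g -> represents (@trace_form f') g.
Proof.
move=> /isometricE[P [Q [PQ QP e]]].
pose act m n (P : 'M[L]_(m, n)) (u : {ffun 'I_m -> L}) : {ffun 'I_n -> L} :=
  [ffun j => (\row_i u i *m P) 0 j].
have actM m n p (P1 : 'M[L]_(m, n)) (P2 : 'M_(n, p)) u :
    act _ _ P2 (act _ _ P1 u) = act _ _ (P1 *m P2) u.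
  apply/ffunP=> i; rewrite !ffunE mulmxA; congr ((_ *m _) 0 i).
  by apply/rowP=> j; rewrite !mxE ffunE mxE.
have act1 m u : act m m 1%:M u = u.
  by apply/ffunP=> i; rewrite ffunE mulmx1 mxE.
apply: (@represents_iso _ _ _ _ _ (act _ _ P)) => [c u v||u v].
- apply/ffunP=> i; rewrite !ffunE !mxE scaler_sumr -big_split /=.
  by apply: eq_bigr => l _; rewrite !mxE !ffunE mulrDl scalerAl.
- by exists (act _ _ Q) => u; rewrite actM ?PQ ?QP act1.
rewrite /trace_form -e; congr (field_trace (_ 0 0)).
have -> : \row_i act _ _ P u i = \row_i u i *m P.
  by apply/rowP=> i; rewrite mxE ffunE.
have -> : \col_i act _ _ P v i = P^T *m \col_i v i.
  apply/colP=> i; rewrite mxE ffunE !mxE; apply: eq_bigr => l _.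
  by rewrite !mxE mulrC.
by rewrite !mulmxA.
Qed.

Lemma trace_form_add f f' g g' :
    represents (@trace_form f) g -> represents (@trace_form f') g' ->
  represents (@trace_form (form_add f f')) (form_add g g').
Proof.
move=> [b [c bc cb] eb] [b' [c' bc' cb'] eb'].
pose V1 := {ffun 'I_(form_dim f) -> L}.
pose V2 := {ffun 'I_(form_dim f') -> L}.
pose V := {ffun 'I_(form_dim f + form_dim f') -> L}.
pose inc1 (u : V1) : V := [ffun i => if split i is inl j then u j else 0].
pose inc2 (u : V2) : V := [ffun i => if split i is inr j then u j else 0].
pose pr1 (u : V) : V1 := [ffun i => u (lshift _ i)].
pose pr2 (u : V) : V2 := [ffun i => u (rshift _ i)].
have spl i : split (lshift _ i : 'I_(form_dim f + form_dim f')) = inl i.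
  exact: (unsplitK (inl i)).
have spr i : split (rshift _ i : 'I_(form_dim f + form_dim f')) = inr i.
  exact: (unsplitK (inr i)).
pose bs (i : 'I_(form_dim g + form_dim g')) : V :=
  match split i with inl j => inc1 (b j) | inr j => inc2 (b' j) end.
have bsl i : bs (lshift _ i) = inc1 (b i) by rewrite /bs (unsplitK (inl i)).
have bsr i : bs (rshift _ i) = inc2 (b' i) by rewrite /bs (unsplitK (inr i)).
have ebs w : lincomb bs w
    = inc1 (lincomb b (lsubmx w)) + inc2 (lincomb b' (rsubmx w)).
  apply/ffunP => i; rewrite !ffunE /lincomb sum_ffunE big_split_ord /=.
  case: (split_ordP i) => j ->; rewrite sum_ffunE.
    rewrite [X in _ + X]big1 ?addr0 => [|l _]; last first.
      by rewrite bsr !ffunE spl scaler0.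
    by apply: eq_bigr => l _; rewrite bsl !ffunE spl !mxE.
  rewrite big1 ?add0r => [|l _]; last by rewrite bsl !ffunE spr scaler0.
  by apply: eq_bigr => l _; rewrite bsr !ffunE spr !mxE.
have pr1K u v : pr1 (inc1 u + inc2 v) = u.
  by apply/ffunP => i; rewrite !ffunE spl addr0.
have pr2K u v : pr2 (inc1 u + inc2 v) = v.
  by apply/ffunP => i; rewrite !ffunE spr add0r.
have E (u v : V) : trace_form (u : {ffun 'I_(form_dim (form_add f f')) -> L}) v
    = trace_form (pr1 u) (pr1 v) + trace_form (pr2 u) (pr2 v).
  rewrite /trace_form -linearD /=; congr field_trace.
  have -> : \row_i u i = row_mx (\row_i pr1 u i) (\row_i pr2 u i).
    apply/rowP=> i; rewrite mxE; case: (split_ordP i) => j ->;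
    by rewrite ?(row_mxEl, row_mxEr) mxE ffunE.
  have -> : \col_i v i = col_mx (\col_i pr1 v i) (\col_i pr2 v i).
    apply/colP=> i; rewrite mxE; case: (split_ordP i) => j ->;
    by rewrite ?(col_mxEu, col_mxEd) mxE ffunE.
  rewrite /form_mx /= mul_row_block !mulmx0 addr0 add0r mul_row_col.
  by rewrite [LHS]mxE.
exists bs.
  exists (fun v : V => row_mx (c (pr1 v)) (c' (pr2 v))) => [w|v].
    by rewrite ebs pr1K pr2K bc bc' hsubmxK.
  rewrite ebs row_mxKl row_mxKr cb cb'; apply/ffunP=> i; rewrite !ffunE.
  by case: (split_ordP i) => j ->; rewrite !ffunE ?addr0 ?add0r.
have trf0 h (u v : {ffun 'I_(form_dim h) -> L}) :
    (u = 0) \/ (v = 0) -> trace_form u v = 0.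
  have [Br Bl] := trace_form_bilinear h.
  case=> ->; first by have := Bl v (-1) 0 0; rewrite /= scaler0 addr0 mulN1r addNr.
  by have := Br u (-1) 0 0; rewrite /= scaler0 addr0 mulN1r addNr.
have p11 u : pr1 (inc1 u) = u by apply/ffunP => i; rewrite !ffunE spl.
have p22 u : pr2 (inc2 u) = u by apply/ffunP => i; rewrite !ffunE spr.
have p12 u : pr1 (inc2 u) = 0 by apply/ffunP => i; rewrite !ffunE spl.
have p21 u : pr2 (inc1 u) = 0 by apply/ffunP => i; rewrite !ffunE spr.
move=> i j; rewrite E /form_mx /=.
case: (split_ordP i) => a ->; case: (split_ordP j) => d ->;
  rewrite ?(bsl, bsr) ?(p11, p22, p12, p21)
    ?(block_mxEul, block_mxEur, block_mxEdl, block_mxEdr) ?mxE.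
- by rewrite (trf0 f') ?addr0 -?eb; auto.
- by rewrite !trf0 ?addr0; auto.
- by rewrite !trf0 ?addr0; auto.
- by rewrite (trf0 f) ?add0r -?eb'; auto.
Qed.

(* When L / k is inseparable the trace vanishes, every positive-dimensional  *)
(* trace form is degenerate and form_trace is the zero morphism.             *)
Definition form_trace (x : form_class L) : form_class k :=
  form_class_of (@trace_form (repr x)).

Lemma form_traceE f :
  form_trace (\pi_(form_class L) f) = form_class_of (@trace_form f).
Proof.
rewrite /form_trace; set f' := repr _.
have i1 : isometric f' f by apply/form_class_eqP; rewrite reprK.
have i2 : isometric f f' by rewrite isometric_sym.
have [[g rg]|nr] := pselect (exists g, represents (@trace_form f) g).
  rewrite (form_class_ofE (trace_form_bilinear f) rg).
  by apply: form_class_ofE (trace_form_bilinear _) (trace_form_isometric i2 rg).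
rewrite !form_class_of0 // => g rg; case: nr; exists g => //.
exact: trace_form_isometric rg.
Qed.

Lemma form_trace_is_nmod_morphism : nmod_morphism form_trace.
Proof.
have tr0 f : (forall x, field_trace x = 0) ->
    form_class_of (@trace_form f) = 0.
  move=> t0; apply: form_class_of0 => g [b _ eb]; apply: form_class0.
  have /andP[_] := form_mxP g; have -> : form_mx g = 0.
    by apply/matrixP => i j; rewrite -eb mxE /trace_form t0.
  by case: (form_dim g) => // d; rewrite unitr0.
have trE : (forall x, field_trace x = 0) \/ (exists x, field_trace x != 0).
  have [h|h] := pselect (exists x, field_trace x != 0); first by right.
  by left=> x; apply/eqP/negPn/negP => hx; apply: h; exists x.
split.
  have -> : 0 = \pi_(form_class L) (form0 L) by rewrite form_class0.
  rewrite form_traceE; case: trE => [/tr0//|/trace_form_represents h].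
  have [g [b [c bc cb] eb]] := h (form0 L).
  rewrite (form_class_ofE (trace_form_bilinear _) (ex_intro2 _ _ b _ eb));
    last by exists c.
  apply: form_class0; case: (form_dim g) b {eb} c bc {cb} => // d b c bc.
  have : const_mx 1 = 0 :> 'rV[k]_d.+1.
    rewrite -[LHS]bc -[RHS]bc; congr c; apply/ffunP; by case.
  by move/rowP/(_ 0); rewrite !mxE => /eqP; rewrite oner_eq0.
elim/quotW=> f; elim/quotW=> f'; rewrite -form_classD !form_traceE.
case: trE => [t0|h]; first by rewrite !tr0 ?addr0.
have [g rg] := trace_form_represents f h.
have [g' rg'] := trace_form_represents f' h.
rewrite (form_class_ofE (trace_form_bilinear _) rg).
rewrite (form_class_ofE (trace_form_bilinear _) rg').
rewrite (form_class_ofE (trace_form_bilinear _) (trace_form_add rg rg')).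
exact: form_classD.
Qed.
HB.instance Definition _ := GRing.isNmodMorphism.Build _ _ form_trace
  form_trace_is_nmod_morphism.

Definition gw_trace (u : GW L) : GW k := gc_map form_trace u.
HB.instance Definition _ := GRing.isZmodMorphism.Build (GW L) (GW k) gw_trace
  (@gc_map_is_zmod_morphism _ _ form_trace).

Lemma gw_traceE f :
  gw_trace (gc_inj (\pi_(form_class L) f)) = gw_class_of (@trace_form f).
Proof. by rewrite /gw_trace gc_map_inj; congr gc_inj; apply: form_traceE. Qed.

End Trace.

Section QuotientByFamily.
Variables (R : comNzRingType) (n : nat) (F : 'I_n -> R).

Definition gen_ideal : {pred R} :=
  fun x => `[< exists c : 'I_n -> R, x = \sum_i c i * F i >].

Lemma gen_ideal_zmod_closed : zmod_closed gen_ideal.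
Proof.
split=> [|x y /asboolP[c ->] /asboolP[d ->]]; apply/asboolP.
  by exists (fun=> 0); rewrite big1 // => i _; rewrite mul0r.
exists (fun i => c i - d i); rewrite -sumrB.
by apply: eq_bigr => i _; rewrite mulrBl.
Qed.
HB.instance Definition _ :=
  GRing.isZmodClosed.Build R gen_ideal gen_ideal_zmod_closed.

Lemma gen_idealM x y : y \in gen_ideal -> x * y \in gen_ideal.
Proof.
move=> /asboolP[c ->]; apply/asboolP; exists (fun i => x * c i).
by rewrite mulr_sumr; apply: eq_bigr => i _; rewrite mulrA.
Qed.

Definition gen_quot := Quotient.quot gen_ideal.
Local Notation Q := gen_quot.
HB.instance Definition _ := GRing.Zmodule.on Q.
HB.instance Definition _ : EqQuotient _ (Quotient.equiv gen_ideal) Q :=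
  EqQuotient.on Q.

Definition gq_proj (x : R) : Q := \pi_Q x.

Lemma gq_projP x y : reflect (x - y \in gen_ideal) (gq_proj x == gq_proj y).
Proof. by rewrite /gq_proj -Quotient.idealrBE; exact: idP. Qed.

Lemma gq_proj_is_zmod_morphism : zmod_morphism gq_proj.
Proof. by move=> x y; rewrite /gq_proj !piE. Qed.
HB.instance Definition _ :=
  GRing.isZmodMorphism.Build R Q gq_proj gq_proj_is_zmod_morphism.

Definition gq_one : Q := gq_proj 1.
Definition gq_mul (u v : Q) : Q := gq_proj (repr u * repr v).

Lemma gq_mulE x y : gq_mul (gq_proj x) (gq_proj y) = gq_proj (x * y).
Proof.
have h z : repr (gq_proj z) - z \in gen_ideal by apply/gq_projP; rewrite /gq_proj reprK.
apply/eqP/gq_projP; set X := repr _; set Y := repr _.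
have -> : X * Y - x * y = X * (Y - y) + y * (X - x).
  by rewrite mulrBr mulrBr (mulrC y X) (mulrC y x) addrA subrK.
by rewrite rpredD ?gen_idealM ?h.
Qed.

Lemma gq_projW (P : Q -> Prop) : (forall x, P (gq_proj x)) -> forall u, P u.
Proof. by move=> h u; rewrite -[u]reprK; apply: h. Qed.

Lemma gq_mulA : associative gq_mul.
Proof.
by elim/gq_projW=> x; elim/gq_projW=> y; elim/gq_projW=> z; rewrite !gq_mulE mulrA.
Qed.
Lemma gq_mulC : commutative gq_mul.
Proof. by elim/gq_projW=> x; elim/gq_projW=> y; rewrite !gq_mulE mulrC. Qed.
Lemma gq_mul1 : left_id gq_one gq_mul.
Proof. by elim/gq_projW=> x; rewrite gq_mulE mul1r. Qed.
Lemma gq_mulDl : left_distributive gq_mul +%R.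
Proof.
elim/gq_projW=> x; elim/gq_projW=> y; elim/gq_projW=> z.
by rewrite -raddfD !gq_mulE mulrDl raddfD.
Qed.
HB.instance Definition _ :=
  GRing.Zmodule_isComPzRing.Build Q gq_mulA gq_mulC gq_mul1 gq_mulDl.

Lemma gq_proj_is_monoid_morphism : monoid_morphism gq_proj.
Proof. by split=> // x y; rewrite -gq_mulE. Qed.
HB.instance Definition _ :=
  GRing.isMonoidMorphism.Build R Q gq_proj gq_proj_is_monoid_morphism.

End QuotientByFamily.

(* Below, q : 'I_n -> L stands for the closed point of A^n_k whose maximal   *)
(* ideal is the kernel of the evaluation g |-> g(q), L being its residue     *)
(* field when the coordinates of q generate L over k.                        *)
Section LocalAlgebra.
Variables (k : fieldType) (L : fieldExtType k) (n : nat).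

Definition peval (q : 'I_n -> L) (g : {mpoly k[n]}) : L := mmap (in_alg L) q g.

Variable q : 'I_n -> L.

Lemma peval_is_zmod_morphism : zmod_morphism (peval q).
Proof. exact: raddfB. Qed.
HB.instance Definition _ := GRing.isZmodMorphism.Build {mpoly k[n]} L (peval q)
  peval_is_zmod_morphism.
Lemma peval_is_monoid_morphism : monoid_morphism (peval q).
Proof. by split=> [|x y]; rewrite /peval ?rmorph1 ?rmorphM. Qed.
HB.instance Definition _ := GRing.isMonoidMorphism.Build {mpoly k[n]} L (peval q)
  peval_is_monoid_morphism.

(* O_{A^n,q} is the ring of fractions a / b with b(q) != 0                   *)
Definition regular_at : {pred {fraction {mpoly k[n]}}} :=
  fun x => `[< exists a b, peval q b != 0 /\ x = tofrac a / tofrac b >].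

Lemma regular_at_subring_closed : subring_closed regular_at.
Proof.
have nz b : peval q b != 0 -> tofrac b != 0.
  by rewrite tofrac_eq0; apply: contra => /eqP ->; rewrite raddf0.
split=> [|x y /asboolP[a [b [b0 ->]]] /asboolP[c [d [d0 ->]]]|
          x y /asboolP[a [b [b0 ->]]] /asboolP[c [d [d0 ->]]]]; apply/asboolP.
- by exists 1, 1; rewrite !rmorph1 oner_neq0 divr1.
- exists (a * d - c * b), (b * d); rewrite rmorphM mulf_neq0 //; split=> //.
  by rewrite rmorphB !rmorphM -[- (_ / _)]mulNr addf_div ?nz // mulNr.
- exists (a * c), (b * d); rewrite !rmorphM mulf_neq0 //; split=> //.
  by rewrite mulf_div.
Qed.
HB.instance Definition _ := GRing.isSubringClosed.Build
  {fraction {mpoly k[n]}} regular_at regular_at_subring_closed.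

Record local_ring := LocalRing { local_val :> {fraction {mpoly k[n]}};
                                 _ : local_val \in regular_at }.
HB.instance Definition _ := [isSub for local_val].
HB.instance Definition _ := [Choice of local_ring by <:].
HB.instance Definition _ := [SubChoice_isSubComNzRing of local_ring by <:].

Lemma local_of_subproof (g : {mpoly k[n]}) : tofrac g \in regular_at.
Proof. by apply/asboolP; exists g, 1; rewrite !rmorph1 oner_neq0 divr1. Qed.
Definition local_of (g : {mpoly k[n]}) : local_ring := LocalRing (local_of_subproof g).

Lemma local_of_is_zmod_morphism : zmod_morphism local_of.
Proof. by move=> x y; apply: val_inj; rewrite /= rmorphB. Qed.
HB.instance Definition _ := GRing.isZmodMorphism.Build {mpoly k[n]} local_ring
  local_of local_of_is_zmod_morphism.
Lemma local_of_is_monoid_morphism : monoid_morphism local_of.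
Proof. by split=> [|x y]; apply: val_inj; rewrite /= ?rmorph1 ?rmorphM. Qed.
HB.instance Definition _ := GRing.isMonoidMorphism.Build {mpoly k[n]} local_ring
  local_of local_of_is_monoid_morphism.

Variable F : 'I_n -> {mpoly k[n]}.

(* Q = O_{A^n,q} / (F_1, .., F_n)                                            *)
Definition local_alg := gen_quot (fun i => local_of (F i)).
HB.instance Definition _ := GRing.ComPzRing.on local_alg.

Definition to_local_alg (g : {mpoly k[n]}) : local_alg :=
  gq_proj (fun i => local_of (F i)) (local_of g).
HB.instance Definition _ := GRing.RMorphism.copy to_local_alg
  (gq_proj (fun i => local_of (F i)) \o local_of).

Definition la_scale (a : k) (u : local_alg) : local_alg := to_local_alg a%:MP * u.

Lemma la_scaleA a b u : la_scale a (la_scale b u) = la_scale (a * b) u.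
Proof. by rewrite /la_scale mulrA mpolyCM rmorphM. Qed.
Lemma la_scale1 : left_id 1 la_scale.
Proof. by move=> u; rewrite /la_scale rmorph1 mul1r. Qed.
Lemma la_scaleDr : right_distributive la_scale +%R.
Proof. by move=> a u v; rewrite /la_scale mulrDr. Qed.
Lemma la_scaleDl u : {morph la_scale^~ u : a b / a + b}.
Proof. by move=> a b; rewrite /la_scale mpolyCD rmorphD mulrDl. Qed.
HB.instance Definition _ := GRing.Zmodule_isLmodule.Build k local_alg
  la_scaleA la_scale1 la_scaleDr la_scaleDl.

End LocalAlgebra.

(* k[y] (x) k[y] is the polynomial ring in 2n variables, y_j (x) 1 and       *)
(* 1 (x) y_j being the variables j and n + j.                                *)
Section SchejaStorch.
Variables (k : fieldType) (n : nat).

Definition tensor_l (g : {mpoly k[n]}) : {mpoly k[n + n]} :=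
  g \mPo [tuple 'X_(lshift n j) | j < n].
Definition tensor_r (g : {mpoly k[n]}) : {mpoly k[n + n]} :=
  g \mPo [tuple 'X_(rshift n j) | j < n].

Definition ss_decomposition (F : 'I_n -> {mpoly k[n]})
    (a : 'M[{mpoly k[n + n]}]_n) : Prop :=
  forall i, tensor_l (F i) - tensor_r (F i)
    = \sum_j a i j * (tensor_l 'X_j - tensor_r 'X_j).

Definition ss_coef (F : 'I_n -> {mpoly k[n]}) : 'M[{mpoly k[n + n]}]_n :=
  xget 0 [set a | ss_decomposition F a]%classic.

Definition mnm_l (m : 'X_{1.. n + n}) : 'X_{1.. n} := [multinom m (lshift n j) | j < n].
Definition mnm_r (m : 'X_{1.. n + n}) : 'X_{1.. n} := [multinom m (rshift n j) | j < n].

Variables (L : fieldExtType k) (q : 'I_n -> L) (F : 'I_n -> {mpoly k[n]}).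
Local Notation Q := (local_alg q F).

(* For D in k[y] (x) k[y], the image in Hom_k (Hom_k (Q, k), Q) of the class  *)
(* of D in Q (x) Q, where u (x) v goes to phi |-> phi(u) v.                  *)
Definition ss_map (D : {mpoly k[n + n]}) (phi : Q -> k) : Q :=
  \sum_(m <- msupp D)
    (D@_m * phi (to_local_alg q F 'X_[mnm_l m])) *: to_local_alg q F 'X_[mnm_r m].

Definition ss_theta : (Q -> k) -> Q := ss_map (\det (ss_coef F)).

Definition ss_eta : Q -> k :=
  xget (fun=> 0) [set phi : Q -> k | scalar phi /\ ss_theta phi = 1]%classic.

Definition ss_form (u v : Q) : k := ss_eta (u * v).

(* This is 0 by convention when q is not isolated in the zero locus of F:    *)
(* then Q is infinite-dimensional, or zero if q is not a zero of F.          *)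
Definition local_degree : GW k := gw_class_of ss_form.

End SchejaStorch.

(* A closed point of P^n_k, given by its residue field, which is a finite    *)
(* extension of k, and by the homogeneous coordinates there of the canonical *)
(* point Spec k(p) -> P^n_k: the affine coordinates in each chart containing *)
(* the point generate k(p).  Conversely such data determine the closed point *)
(* whose homogeneous ideal is generated by the forms vanishing at them, and  *)
(* identify its residue field.                                               *)
Record closed_point (k : fieldType) (n : nat) := ClosedPoint {
  residue_field : fieldExtType k;
  hcoord : 'I_n.+1 -> residue_field;
  hcoord_neq0 : exists i, hcoord i != 0;
  hcoord_gen : forall l, hcoord l != 0 ->
    <<1 & [seq hcoord i / hcoord l | i <- enum 'I_n.+1]>>%VS = fullv
}.

Section ProjectiveSpace.
Variables (k : fieldType) (n : nat).
Implicit Types (f : {mpoly k[n.+1]}) (p : closed_point k n) (l : 'I_n.+1).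

Definition hypersurface f : Prop :=
  f != 0 /\ exists2 d, (0 < d)%N & f \is d.-homog.

Definition in_chart p l : Prop := hcoord p l != 0.

Definition value_at p f : residue_field p := peval (hcoord p) f.

Definition gradient_at p f : 'cV[residue_field p]_n.+1 :=
  \col_j value_at p f^`M(j).

Definition lies_on p f : Prop := value_at p f = 0.

Definition smooth_at p f : Prop := gradient_at p f != 0.

(* T_p P^n is k(p)^(n+1) modulo the line of the homogeneous coordinates, in  *)
(* the form of the row space of the cokernel of this line; T_p f is the      *)
(* image in it of the kernel of the gradient.                                *)
Definition coord_row p : 'rV[residue_field p]_n.+1 := \row_j hcoord p j.

Definition tangent_Pn p : 'M[residue_field p]_n.+1 := cokermx (coord_row p).

Lemma rank_tangent_Pn p : \rank (tangent_Pn p) = n.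
Proof.
rewrite /tangent_Pn mxrank_coker rank_rV; have [i ci] := hcoord_neq0 p.
have -> : coord_row p != 0 by apply/rV0Pn; exists i; rewrite mxE.
by rewrite subn1.
Qed.

Definition tangent p f : 'M[residue_field p]_n.+1 :=
  kermx (gradient_at p f) *m cokermx (coord_row p).

Definition codim p (W : 'M[residue_field p]_n.+1) : nat :=
  \rank (tangent_Pn p) - \rank W.

Definition transverse_at p (f : 'I_n -> {mpoly k[n.+1]}) : Prop :=
  [/\ forall i, lies_on p (f i),
      forall i, smooth_at p (f i) &
      codim (\bigcap_i tangent p (f i))%MS = (\sum_i codim (tangent p (f i)))%N].

(* The coordinates on U_l are indexed by 'I_n through [lift l], which lists  *)
(* the j != l in increasing order; the sign (-1)^l is carried by x_0.        *)
Definition chart_sign (S : pzRingType) l (i : 'I_n.+1) : S :=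
  if i == ord0 then (-1) ^+ l else 1.

Definition chart_coord l p (j : 'I_n) : residue_field p :=
  chart_sign _ l (lift l j) * (hcoord p (lift l j) / hcoord p l).

Definition chart_subst l : n.+1.-tuple {mpoly k[n]} :=
  [tuple if unlift l i is Some j then chart_sign _ l i * 'X_j else 1 | i < n.+1].

Definition chart_expr l f : {mpoly k[n]} := f \mPo chart_subst l.

Definition section_degree l (f : 'I_n -> {mpoly k[n.+1]}) p : GW k :=
  local_degree (chart_coord l p) (fun i => chart_expr l (f i)).

Definition jacobian l (f : 'I_n -> {mpoly k[n.+1]}) : {mpoly k[n]} :=
  \det (\matrix_(i, j) (chart_expr l (f i))^`M(j)).

End ProjectiveSpace.

Definition perfect_field (k : fieldType) : Prop :=
  forall p, p \in [pchar k] -> forall x : k, exists y, y ^+ p = x.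

(* Main.v *)
Require Import Defs.
From HB Require Import structures.
From mathcomp Require Import all_boot all_order all_algebra all_field.
From mathcomp Require Import boolp classical_sets.
From mathcomp Require Import ssrcomplements mpoly.

Set Implicit Arguments.
Unset Strict Implicit.
Unset Printing Implicit Defensive.

Import GRing.Theory.

Local Open Scope ring_scope.

(** Transversality says that the affine point [q] of [p] in the chart is a
    simple zero of the map [F] given by the chart expressions of the [f i]:
    every row vector killed by all the gradients is a multiple of the
    homogeneous coordinates of [p] (Euler's identity puts these coordinates in
    every kernel, so that each tangent hyperplane has codimension at least one
    in the tangent space, and transversality then leaves no room for another
    direction).  Hence the Jacobian determinant [J] of [F] at [q] is nonzero
    ([transverse_det_jacobian_neq0]).

    At a simple zero with residue field [L], the local algebra [Q] is [L].  The
    ideal of [q] in k[y] is generated by as many polynomials [G j] as there are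
    variables, by a tower of minimal polynomials ([peval_kernel_gens]); writing
    [F] as a matrix [C] times [G] and differentiating gives
    [J = det C(q) * det (dG/dy)(q)], so that [C] is invertible in the local
    ring and [F] generates the maximal ideal there
    ([peval_eq0_to_local_alg]).

    It remains to compute the Scheja-Storch functional [eta] on [L].  Let
    [D = det (a i j)], seen as an element [sum u_s (x) v_s] of [L (x) L].  Two
    facts determine how it contracts with functionals:
    - by Cramer's rule, [D] times [y j (x) 1 - 1 (x) y j] is a combination of
      the [F i (x) 1 - 1 (x) F i]; as [F] vanishes at [q], both actions of [L]
      on [D] agree ([contract_balanced]);
    - differentiating the relation that defines the [a i j] and restricting to
      the diagonal turns [a] into the Jacobian matrix, so that
      [sum u_s v_s = J] ([peval_diag_det]).
    With the definition of the trace through a basis and its coordinates,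
    these two facts give [sum Tr(u_s) v_s = J] ([contract_trace]), and
    [Tr(c * sum phi(u_s) v_s) = phi(c J)] for every functional [phi]
    ([trace_contract]).  The former shows that [x |-> Tr(x / J)] is sent to 1
    by [Theta], the latter that it is the only such functional.  So the
    Scheja-Storch form is [(x, y) |-> Tr(x y / J)], which rescaling by [J]
    identifies with [(x, y) |-> Tr(J x y)].  Since [J] is a value of the
    contraction with the trace, the trace form of [L] is non-degenerate. *)

(** * Polynomials and their values at a point *)

(** Most identities below are between ring morphisms or derivations, so that
    it is enough to check them on constants and variables. *)
Lemma mpoly_ring_ind (R : comNzRingType) (n : nat) (P : {mpoly R[n]} -> Prop) :
    (forall c, P c%:MP) -> (forall i, P 'X_i) ->
    (forall g h, P g -> P h -> P (g + h)) ->
    (forall g h, P g -> P h -> P (g * h)) ->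
  forall g, P g.
Proof.
move=> PC PX PD PM; elim/mpolyind => [|c m g _ _ Pg]; first by rewrite -mpolyC0.
apply: (PD) Pg; rewrite -mul_mpolyC; apply: (PM) => //; rewrite mpolyXE_id.
elim/big_rec: _ => [|i h _ Ph]; first by rewrite -mpolyC1.
apply: (PM) => //; elim: (m i) => [|e IH]; first by rewrite expr0 -mpolyC1.
by rewrite exprS; apply: (PM).
Qed.

Lemma mderivXU (R : comNzRingType) n (i j : 'I_n) :
  ('X_i : {mpoly R[n]})^`M(j) = (i == j)%:R.
Proof.
rewrite mderivX mnm1E; have [->|_] := eqVneq i j; last by rewrite scale0r.
rewrite scale1r -[RHS]mpolyX0; congr 'X_[_].
by apply/mnmP=> s; rewrite mnmBE subnn mnm0E.
Qed.

Lemma mderiv_comp (R : comNzRingType) m n (t : m.-tuple {mpoly R[n]}) g j :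
  (g \mPo t)^`M(j) = \sum_i (g^`M(i) \mPo t) * (tnth t i)^`M(j).
Proof.
elim/mpoly_ring_ind: g => [c|i|g h IHg IHh|g h IHg IHh].
- by rewrite comp_mpolyC mderivC big1 // => i _; rewrite mderivC rmorph0 mul0r.
- rewrite comp_mpolyXU -tnth_nth (bigD1 i) //= mderivXU eqxx rmorph1 mul1r.
  by rewrite big1 ?addr0 // => s /negPf si;
    rewrite mderivXU eq_sym si rmorph0 mul0r.
- rewrite rmorphD mderivD IHg IHh -big_split; apply: eq_bigr => i _.
  by rewrite mderivD rmorphD mulrDl.
- rewrite rmorphM mderivM IHg IHh mulr_suml mulr_sumr -big_split.
  apply: eq_bigr => i _ /=; rewrite mderivM rmorphD !rmorphM mulrDl.
  by rewrite mulrAC -!mulrA (mulrC (h \mPo t)).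
Qed.

Section Evaluation.
Variables (k : fieldType) (L : fieldExtType k).

Lemma pevalC n (q : 'I_n -> L) c : peval q c%:MP = c%:A.
Proof. by rewrite /peval mmapC. Qed.

Lemma pevalX n (q : 'I_n -> L) i : peval q 'X_i = q i.
Proof. by rewrite /peval mmapX mmap1U. Qed.

Lemma pevalZ n (q : 'I_n -> L) c g : peval q (c *: g) = c *: peval q g.
Proof. by rewrite -mul_mpolyC rmorphM /= pevalC mulr_algl. Qed.

Lemma eq_peval n (q q' : 'I_n -> L) : q =1 q' -> peval q =1 peval q'.
Proof. by move=> e g; congr (peval _ g); apply: funext. Qed.

Lemma peval_comp m n (q : 'I_n -> L) (t : m.-tuple {mpoly k[n]}) g :
  peval q (g \mPo t) = peval (fun i => peval q (tnth t i)) g.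
Proof.
elim/mpoly_ring_ind: g => [c|i|g h IHg IHh|g h IHg IHh].
- by rewrite comp_mpolyC !pevalC.
- by rewrite comp_mpolyXU -tnth_nth pevalX.
- by rewrite !rmorphD /= IHg IHh.
- by rewrite !rmorphM /= IHg IHh.
Qed.

Lemma peval_adjoin n (q : 'I_n -> L) g :
  peval q g \in <<1 & [seq q i | i <- enum 'I_n]>>%VS.
Proof.
elim/mpoly_ring_ind: g => [c|i|g h IHg IHh|g h IHg IHh].
- by rewrite pevalC rpredZ // rpred1.
- by rewrite pevalX seqv_sub_adjoin // map_f // mem_enum.
- by rewrite rmorphD rpredD.
- by rewrite rmorphM rpredM.
Qed.

(** Adjoin the elements of [rs] one at a time: since [L] is finite over [k],
    the field [K(y)] consists of the polynomials in [y] over [K]. *)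
Lemma adjoin_peval n (q : 'I_n -> L) (rs : seq L) x :
    (forall y, y \in rs -> exists g, peval q g = y) ->
  x \in <<1 & rs>>%VS -> exists g, peval q g = x.
Proof.
elim/last_ind: rs x => [|rs y IH] x rsq.
  rewrite Fadjoin_nil => /vlineP[c ->]; exists c%:MP.
  by rewrite pevalC.
have {}IH z : z \in <<1 & rs>>%VS -> exists g, peval q g = z.
  by apply: IH => w wrs; apply: rsq; rewrite mem_rcons inE wrs orbT.
have [gy <-] : exists g, peval q g = y by apply: rsq;
  rewrite mem_rcons mem_head.
rewrite adjoin_rcons => /Fadjoin_polyP[p /polyOverP pK ->].
have /choice[c cE] i : exists g, peval q g = p`_i by apply: IH.
exists (\sum_(i < size p) c i * gy ^+ i); rewrite rmorph_sum horner_coef /=.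
by apply: eq_bigr => i _; rewrite rmorphM rmorphXn /= cE.
Qed.

End Evaluation.

Section Homogeneous.
Variables (k : fieldType) (L : fieldExtType k) (n : nat) (x : 'I_n -> L).

Lemma peval_sum (g : {mpoly k[n]}) :
  peval x g = \sum_(m <- msupp g) g@_m *: peval x 'X_[m].
Proof.
rewrite [in LHS](mpolyE g) rmorph_sum; apply: eq_bigr => m _.
by rewrite /= pevalZ.
Qed.

Lemma peval_homog c d (g : {mpoly k[n]}) : g \is d.-homog ->
  peval (fun i => c * x i) g = c ^+ d * peval x g.
Proof.
move=> /dhomogP gd; rewrite peval_sum [in LHS]/peval.
rewrite /mmap mulr_sumr; apply: eq_big_seq => m /gd /= md.
rewrite /peval mmapX /mmap1 mulr_algl -scalerAr; congr (_ *: _).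
rewrite -md mdegE -prodrXr -big_split.
by apply: eq_bigr => i _; rewrite exprMn.
Qed.

Lemma mderiv_homog d j (g : {mpoly k[n]}) :
  g \is d.-homog -> g^`M(j) \is d.-1.-homog.
Proof.
move=> gd; apply/dhomogP => m; rewrite mcoeff_msupp mcoeff_deriv => nz.
have : (m + U_(j))%MM \in msupp g.
  by rewrite mcoeff_msupp; apply: contra nz => /eqP ->; rewrite mul0rn.
by move/(dhomogP _ _ _ gd) => <- /=; rewrite mdegD mdeg1 addn1.
Qed.

(** Both sides are linear in [g], and a monomial [m] is multiplied by [m j]
    under [x j] times the [j]-th derivative. *)
Lemma euler_homog d (g : {mpoly k[n]}) : g \is d.-homog ->
  \sum_j x j * peval x g^`M(j) = d%:R * peval x g.
Proof.
move=> /dhomogP gd; have eX m :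
    \sum_j x j * peval x 'X_[m]^`M(j) = (mdeg m)%:R * peval x 'X_[m].
  rewrite mdegE natr_sum mulr_suml; apply: eq_bigr => j _.
  rewrite mderivX pevalZ scaler_nat mulrnAr mulr_natl.
  have [->|mj] := eqVneq (m j) 0%N; first by rewrite !mulr0n.
  congr (_ *+ _); rewrite -(pevalX x j) -rmorphM -mpolyXD /=.
  by congr (peval _ 'X_[_]); rewrite addmC submK // lep1mP.
rewrite peval_sum mulr_sumr.
transitivity (\sum_j \sum_(m <- msupp g) g@_m *: (x j * peval x 'X_[m]^`M(j))).
  apply: eq_bigr => j _; rewrite [in LHS](mpolyE g) (linear_sum (mderiv j))
    rmorph_sum.
  by rewrite mulr_sumr; apply: eq_bigr => m _;
    rewrite /= mderivZ pevalZ scalerAr.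
rewrite exchange_big; apply: eq_big_seq => m /gd /= <-.
by rewrite -scaler_sumr eX scalerAr.
Qed.

End Homogeneous.

(** * The ideal of a closed point of affine space has n generators *)

Section KernelOfEvaluation.
Variables (k : fieldType) (L : fieldExtType k) (n : nat).
Implicit Types (q : 'I_n.+1 -> L) (p : {poly {mpoly k[n]}}).

(** The variable 0 is singled out: [k[y_0, .., y_n]] is the ring of
    polynomials in [y_0] over the polynomials in the other variables. *)
Definition widen0 : {mpoly k[n]} -> {mpoly k[n.+1]} :=
  comp_mpoly [tuple 'X_(lift ord0 i) | i < n].
HB.instance Definition _ := GRing.RMorphism.on widen0.

Definition eval_var0 p : {mpoly k[n.+1]} := (map_poly widen0 p).['X_ord0].
HB.instance Definition _ := GRing.RMorphism.copy eval_var0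
  (horner_eval ('X_ord0) \o map_poly widen0).

Lemma peval_widen0 q g : peval q (widen0 g) = peval (fun i => q (lift ord0 i))
  g.
Proof.
rewrite peval_comp; apply: eq_peval => i.
by rewrite tnth_mktuple pevalX.
Qed.

Lemma peval_eval_var0 q p : peval q (eval_var0 p)
  = (map_poly (peval (fun i => q (lift ord0 i))) p).[q ord0].
Proof.
rewrite /eval_var0 -horner_map /= pevalX -map_poly_comp.
by congr (_.[_]); apply: eq_map_poly => g /=; rewrite peval_widen0.
Qed.

Lemma eval_var0_surj g : exists p, eval_var0 p = g.
Proof.
elim/mpoly_ring_ind: g => [c|i|g h [a <-] [b <-]|g h [a <-] [b <-]].
- by exists (c%:MP)%:P; rewrite /eval_var0 map_polyC hornerC /= /widen0
  comp_mpolyC.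
- case: (unliftP ord0 i) => [j|] ->; last first.
    by exists 'X; rewrite /eval_var0 map_polyX hornerX.
  exists ('X_j)%:P; rewrite /eval_var0 map_polyC hornerC /= /widen0
    comp_mpolyXU.
  by rewrite -tnth_nth tnth_mktuple.
- by exists (a + b); rewrite rmorphD.
- by exists (a * b); rewrite rmorphM.
Qed.

End KernelOfEvaluation.

Lemma monic_lift (k : fieldType) (L : fieldExtType k) n (q : 'I_n -> L)
    (M : {poly L}) :
    M \is monic -> (forall i, exists g, peval q g = M`_i) ->
  exists2 P, P \is monic & map_poly (peval q) P = M /\ size P = size M.
Proof.
move=> Mm /choice[c cE]; pose d := (size M).-1.
have sM : size M = d.+1 by rewrite prednK // size_poly_gt0 monic_neq0.
have sP : size ('X^d + \poly_(i < d) c i) = d.+1.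
  by rewrite size_polyDl size_polyXn // ltnS size_poly.
exists ('X^d + \poly_(i < d) c i); last split; last by rewrite sP.
  rewrite monicE lead_coefDl ?lead_coefXn // size_polyXn ltnS.
  exact: size_poly.
apply/polyP=> i; rewrite coef_map_id0 ?rmorph0 //= coefD coefXn coef_poly.
case: (ltngtP i d) => [id|di|->].
- by rewrite add0r cE.
- by rewrite addr0 rmorph0 nth_default // sM.
- by rewrite addr0 rmorph1; have := Mm; rewrite monicE /lead_coef => /eqP.
Qed.

(** Induction on the number of variables.  Let [K] be the field generated by the
    coordinates other than [q ord0].  The generators are those of the point
    with these coordinates, and a monic lift [P] of the minimal polynomial of
    [q ord0] over [K].  The remainder of a polynomial modulo [P] has smaller
    degree in [y_0]; if it vanishes at [q] then its coefficients vanish at the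
    projected point, by minimality, and the induction hypothesis applies to
    each of them. *)
Theorem peval_kernel_gens (k : fieldType) (L : fieldExtType k) n (q : 'I_n ->
  L) :
  exists2 G : 'I_n -> {mpoly k[n]}, (forall i, peval q (G i) = 0) &
    forall g, peval q g = 0 -> exists c, g = \sum_i c i * G i.
Proof.
elim: n q => [|n IH] q.
  exists (fun=> 0) => [[]//|g]; rewrite [g]nvar0_mpolyC pevalC => /eqP.
  rewrite scaler_eq0 oner_eq0 orbF => /eqP->.
  by exists (fun=> 0); rewrite big_ord0 mpolyC0.
pose q' i := q (lift ord0 i); have [G' G'0 G'g] := IH q'.
pose K := <<1 & [seq q' i | i <- enum 'I_n]>>%AS.
have Kl x : x \in K -> exists g, peval q' g = x.
  apply: adjoin_peval => y /mapP[i _ ->].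
  by exists 'X_i; rewrite pevalX.
have := monic_minPoly K (q ord0); set M := minPoly _ _ => Mm.
have MK : M \is a polyOver K := minPolyOver _ _.
have [|P Pm [PM sP]] := @monic_lift _ _ _ q' _ Mm.
  by move=> i; apply: Kl; apply: (polyOverP MK).
pose G i := if unlift ord0 i is Some j then widen0 (G' j) else eval_var0 P.
exists G => [i|g].
  rewrite /G; case: unliftP => [j _|_]; first by rewrite peval_widen0 G'0.
  by rewrite peval_eval_var0 -/q' PM; apply/eqP; apply: root_minPoly.
have [p <-] := eval_var0_surj g; pose r := Pdiv.Ring.rmodp p P.
rewrite [in peval q _](Pdiv.RingMonic.rdivp_eq Pm p) -/r rmorphD rmorphM /=.
rewrite [peval q _]rmorphD [X in X + _]rmorphM /= !peval_eval_var0 -/q' PM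
  minPolyxx mulr0 add0r.
move=> gq; have r0 : map_poly (peval q') r = 0.
  apply/eqP; rewrite -(@root_small_adjoin_poly _ _ K (q ord0));
    first exact/rootP.
    by apply/polyOverP=> i; rewrite coef_map_id0 ?rmorph0 //= peval_adjoin.
  apply: leq_trans (size_poly _ _) _; rewrite -ltnS -(size_minPoly K (q ord0)).
  by rewrite -/M -sP Pdiv.Ring.ltn_rmodpN0 ?monic_neq0.
have /choice[c cE] i : exists c, r`_i = \sum_j c j * G' j.
  by apply: G'g; have /polyP/(_ i) := r0;
    rewrite coef_map_id0 ?rmorph0 //= coef0.
exists (fun i => if unlift ord0 i is Some j
  then eval_var0 (\poly_(s < size r) c s j) else eval_var0 (Pdiv.Ring.rdivp p
    P)).
rewrite big_ord_recl /G unlift_none {1}(Pdiv.RingMonic.rdivp_eq Pm p) -/r.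
rewrite [LHS]rmorphD [X in X + _]rmorphM; congr (_ + _).
under eq_bigr => j _.
  rewrite liftK.
  have <- : eval_var0 (G' j)%:P = widen0 (G' j) by rewrite /eval_var0 map_polyC
    hornerC.
  rewrite -rmorphM /=; over.
rewrite -rmorph_sum; congr eval_var0; apply/polyP=> i; rewrite coef_sum.
have [ir|ri] := ltnP i (size r); last first.
  rewrite nth_default // big1 // => j _.
  by rewrite coefMC coef_poly ltnNge ri mul0r.
by rewrite cE; apply: eq_bigr => j _; rewrite coefMC coef_poly ir.
Qed.

(** * The local algebra at a simple zero is the residue field *)

Section Jacobian.
Variables (k : fieldType) (L : fieldExtType k) (n : nat) (q : 'I_n -> L).

Definition jacobian_mx (F : 'I_n -> {mpoly k[n]}) : 'M[L]_n :=
  \matrix_(i, j) peval q (F i)^`M(j).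

Lemma det_jacobian_mx F :
  \det (jacobian_mx F) = peval q (\det (\matrix_(i, j) (F i)^`M(j))).
Proof. by rewrite -det_map_mx; congr (\det _); apply/matrixP=> i j;
  rewrite !mxE. Qed.

(** The terms in the derivatives of [C] disappear at a common zero of [G]. *)
Lemma jacobian_mx_mul (C : 'M[{mpoly k[n]}]_n) F G :
    (forall i, F i = \sum_j C i j * G j) -> (forall i, peval q (G i) = 0) ->
  jacobian_mx F = map_mx (peval q) C *m jacobian_mx G.
Proof.
move=> FE G0; apply/matrixP=> i j; rewrite !mxE FE (linear_sum (mderiv j))
  rmorph_sum /=.
apply: eq_bigr => s _; rewrite mderivM rmorphD !rmorphM /= G0 mulr0 add0r.
by rewrite !mxE.
Qed.

End Jacobian.

Section LocalAlgebraIsResidueField.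
Variables (k : fieldType) (L : fieldExtType k) (n : nat) (q : 'I_n -> L).
Variable F : 'I_n -> {mpoly k[n]}.
Hypothesis F0 : forall i, peval q (F i) = 0.
Local Notation Q := (local_alg q F).
Local Notation tla := (to_local_alg q F).

Lemma tofrac_neq0 b : peval q b != 0 -> tofrac b != 0.
Proof. by rewrite tofrac_eq0; apply: contra => /eqP ->; rewrite rmorph0. Qed.

Lemma local_unit b : peval q b != 0 -> exists w, w * local_of q b = 1.
Proof.
move=> b0; have wr : tofrac 1 / tofrac b \in regular_at q.
  by apply/asboolP; exists 1, b.
exists (LocalRing wr); apply: val_inj.
by rewrite /= rmorph1 div1r mulVf ?tofrac_neq0.
Qed.

Lemma to_local_alg_unit b : peval q b != 0 -> exists w, w * tla b = 1.
Proof.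
move=> /local_unit[w wb]; exists (gq_proj _ w).
by rewrite /to_local_alg -rmorphM wb rmorph1.
Qed.

Lemma to_local_alg_gen i : tla (F i) = 0.
Proof.
apply/eqP; rewrite /to_local_alg -(rmorph0 (gq_proj (fun i => local_of q (F
  i)))).
apply/gq_projP; rewrite subr0; apply/asboolP.
exists (fun j => (i == j)%:R); rewrite (bigD1 i) //= eqxx mul1r big1 ?addr0 //.
by move=> j /negPf ji; rewrite eq_sym ji mul0r.
Qed.

(** The fractions [a / b] with [a(q) = 0] form an ideal that contains [F]. *)
Lemma to_local_alg_eq0_peval g : tla g = 0 -> peval q g = 0.
Proof.
rewrite /to_local_alg -(rmorph0 (gq_proj (fun i => local_of q (F i)))).
move=> /eqP/gq_projP; rewrite subr0 => /asboolP[c gE].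
pose P (x : local_ring q) := exists a b,
  [/\ peval q a = 0, peval q b != 0 & val x = tofrac a / tofrac b].
have : P (local_of q g).
  rewrite gE; elim/big_ind: _ => [|x y|i _].
  - by exists 0, 1; rewrite !rmorph0 rmorph1 oner_neq0 mul0r.
  - move=> [a [b [a0 b0 xE]]] [a' [b' [a'0 b'0 yE]]].
    exists (a * b' + a' * b), (b * b'); split.
    + by rewrite rmorphD !rmorphM /= a0 a'0 !mul0r addr0.
    + by rewrite rmorphM /= mulf_neq0.
    by rewrite /= xE yE addf_div ?tofrac_neq0 // rmorphD !rmorphM.
  - have /asboolP[a [b [b0 cE]]] := valP (c i).
    exists (a * F i), b; split=> //; first by rewrite rmorphM /= F0 mulr0.
    by rewrite /= cE rmorphM mulrAC.
move=> [a [b [a0 b0 e]]].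
have : tofrac (g * b) = tofrac a.
  by rewrite rmorphM /= -[tofrac g]/(val (local_of q g)) e divfK ?tofrac_neq0.
move=> /eqP; rewrite tofrac_eq => /eqP gb.
apply/eqP; have : peval q (g * b) == 0 by rewrite gb a0.
by rewrite rmorphM mulf_eq0 /= (negPf b0) orbF.
Qed.

Hypothesis J0 : \det (jacobian_mx q F) != 0.

(** The Jacobian matrix of [F] is the product of the matrix [C(q)], which
    expresses [F] in the [n] generators [G] of the ideal of [q], with the
    Jacobian matrix of [G].  So [det C] is a unit of the local ring, and the
    adjugate of [C] expresses [det C] times [G] in terms of [F]. *)
Lemma peval_eq0_to_local_alg g : peval q g = 0 -> tla g = 0.
Proof.
have [G G0 Gg] := peval_kernel_gens q.
move=> /Gg[c ->]; rewrite rmorph_sum big1 // => s _.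
rewrite rmorphM /=; suff -> : tla (G s) = 0 by rewrite mulr0.
have /choice[C CE] i : exists c, F i = \sum_j c j * G j by apply: Gg.
pose M := \matrix_(i, j) C i j.
have d0 : peval q (\det M) != 0.
  have := J0; rewrite (@jacobian_mx_mul _ _ _ _ M F G) // => [|i].
    by rewrite det_mulmx det_map_mx mulf_eq0 negb_or => /andP[].
  by rewrite CE; apply: eq_bigr => j _; rewrite mxE.
have dG : \det M * G s = \sum_i \adj M s i * F i.
  pose Gc := \col_i G i; have FE : M *m Gc = \col_i F i.
    by apply/colP=> i; rewrite !mxE CE; apply: eq_bigr => j _; rewrite !mxE.
  have := congr1 (fun A : 'cV__ => A s 0) (mulmxA (\adj M) M Gc).
  rewrite mul_adj_mx mul_scalar_mx FE !mxE => <-.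
  by apply: eq_bigr => i _; rewrite !mxE.
have [w wd] := to_local_alg_unit d0.
rewrite -[LHS]mul1r -wd -mulrA -rmorphM /= dG rmorph_sum big1 ?mulr0 // => i _.
by rewrite rmorphM /= to_local_alg_gen mulr0.
Qed.

Hypothesis q_gen : forall x, exists g, peval q g = x.

Lemma to_local_alg_surj u : exists g, u = tla g.
Proof.
elim/gq_projW: u => x; have /asboolP[a [b [b0 xE]]] := valP x.
have [c cE] := q_gen (peval q b)^-1; exists (a * c).
have bc : tla (b * c) = 1.
  apply/eqP; rewrite -subr_eq0 -(rmorph1 tla) -rmorphB; apply/eqP.
  by apply: peval_eq0_to_local_alg; rewrite rmorphB rmorphM rmorph1 /= cE divff
    // subrr.
rewrite -[LHS]mulr1 -bc /to_local_alg -!rmorphM; congr gq_proj; apply: val_inj.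
by rewrite /= xE !rmorphM mulrA divfK ?tofrac_neq0.
Qed.

(** The isomorphism is taken in this direction because a polynomial with a
    prescribed value is all that it needs: no quotient has to be mapped out
    of. *)
Definition from_residue (x : L) : Q := tla (projT1 (cid (q_gen x))).

Lemma from_residueE g : from_residue (peval q g) = tla g.
Proof.
apply/eqP; rewrite -subr_eq0 -rmorphB; apply/eqP/peval_eq0_to_local_alg.
by rewrite rmorphB /= (projT2 (cid (q_gen _))) subrr.
Qed.

Lemma from_residueM : {morph from_residue : x y / x * y}.
Proof.
move=> x y; have [g <-] := q_gen x; have [h <-] := q_gen y.
by rewrite -rmorphM !from_residueE rmorphM.
Qed.

Lemma from_residue_is_linear : linear from_residue.
Proof.
move=> a x y; have [g <-] := q_gen x; have [h <-] := q_gen y.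
rewrite -pevalZ -rmorphD !from_residueE rmorphD /= -mul_mpolyC rmorphM.
by [].
Qed.
HB.instance Definition _ :=
  GRing.isLinear.Build k L Q _ from_residue from_residue_is_linear.

Lemma from_residue_bij : bijective from_residue.
Proof.
have s u : exists x, from_residue x = u.
  by have [g ->] := to_local_alg_surj u; exists (peval q g);
    rewrite from_residueE.
exists (fun u => projT1 (cid (s u))) => [x|u]; last exact: projT2 (cid (s u)).
apply/eqP; rewrite -subr_eq0; set y := projT1 _; have [g gE] := q_gen (y - x).
rewrite -gE; apply/eqP/to_local_alg_eq0_peval.
by rewrite -from_residueE gE raddfB /= (projT2 (cid (s _))) subrr.
Qed.

End LocalAlgebraIsResidueField.

(** * The determinant of Scheja and Storch as an element of L (x) L *)

Section Decomposition.
Variables (k : fieldType) (n : nat).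

(** Write [d g] for [g (x) 1 - 1 (x) g]; products are decomposed by the Leibniz
    rule [d (g h) = (h (x) 1) d g + (1 (x) g) d h]. *)
Lemma tensor_diff (g : {mpoly k[n]}) : exists a : 'I_n -> {mpoly k[n + n]},
  tensor_l g - tensor_r g = \sum_j a j * (tensor_l 'X_j - tensor_r 'X_j).
Proof.
elim/mpoly_ring_ind: g => [c|i|g h [a aE] [b bE]|g h [a aE] [b bE]].
- exists (fun=> 0); rewrite /tensor_l /tensor_r !comp_mpolyC subrr big1 // => j
  _.
  by rewrite mul0r.
- exists (fun j => (i == j)%:R); rewrite (bigD1 i) //= eqxx mul1r big1 ?addr0
  //.
  by move=> j /negPf ji; rewrite eq_sym ji mul0r.
- exists (fun j => a j + b j); rewrite /tensor_l /tensor_r !rmorphD opprD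
  addrACA.
  by rewrite aE bE -big_split; apply: eq_bigr => j _; rewrite mulrDl.
- exists (fun j => tensor_l h * a j + tensor_r g * b j).
  transitivity (tensor_l h * (tensor_l g - tensor_r g)
              + tensor_r g * (tensor_l h - tensor_r h)).
    rewrite /tensor_l /tensor_r !rmorphM !mulrBr addrA /=.
    by rewrite [in RHS](mulrC _ (g \mPo _)) (mulrC (h \mPo _) (g \mPo _)) subrK.
  rewrite aE bE !mulr_sumr -big_split; apply: eq_bigr => j _.
  by rewrite mulrDl !mulrA.
Qed.

Lemma ss_coefP (F : 'I_n -> {mpoly k[n]}) : ss_decomposition F (ss_coef F).
Proof.
rewrite /ss_coef; case: xgetP => // /(_ _)/= no.
have /choice[a aE] i := tensor_diff (F i).
case: (no (\matrix_(i, j) a i j)) => i; rewrite aE.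
by apply: eq_bigr => j _; rewrite mxE.
Qed.

(** Cramer's rule for the system satisfied by the [y_j (x) 1 - 1 (x) y_j]. *)
Lemma det_ss_coefX (F : 'I_n -> {mpoly k[n]}) j :
  \det (ss_coef F) * (tensor_l 'X_j - tensor_r 'X_j)
    = \sum_i \adj (ss_coef F) j i * (tensor_l (F i) - tensor_r (F i)).
Proof.
set A := ss_coef F; pose v := \col_j (tensor_l 'X_j - tensor_r 'X_j : {mpoly
  k[n + n]}).
have FE : A *m v = \col_i (tensor_l (F i) - tensor_r (F i)).
  apply/colP=> i; rewrite !mxE ss_coefP.
  by apply: eq_bigr => s _; rewrite !mxE.
have := congr1 (fun M : 'cV__ => M j 0) (mulmxA (\adj A) A v).
rewrite mul_adj_mx mul_scalar_mx FE !mxE => <-.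
by apply: eq_bigr => i _; rewrite !mxE.
Qed.

End Decomposition.

Section MonomialSum.
Variables (k : fieldType) (n : nat) (V : lmodType k) (w : 'X_{1..n} -> V).

(** The linear map on polynomials with prescribed values on the monomials. *)
Definition mnm_sum (D : {mpoly k[n]}) : V := \sum_(m <- msupp D) D@_m *: w m.

Lemma mnm_sumE i D : (msize D <= i)%N ->
  mnm_sum D = \sum_(m : 'X_{1..n < i}) D@_m *: w m.
Proof.
move=> Di; rewrite /mnm_sum (big_mksub 'X_{1..n < i}) ?msupp_uniq //=;
  last first.
  by move=> x /msize_mdeg_lt /leq_trans; apply.
by rewrite big_rmcond //= => j /memN_msupp_eq0 ->; rewrite scale0r.
Qed.

Lemma mnm_sum_is_linear : linear mnm_sum.
Proof.
move=> c p r; set i := maxn (msize (c *: p + r)) (maxn (msize p) (msize r)).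
rewrite !(@mnm_sumE i) ?leq_max ?leqnn ?orbT // scaler_sumr -big_split.
by apply: eq_bigr => m _; rewrite mcoeffD mcoeffZ scalerDl scalerA.
Qed.
HB.instance Definition _ := GRing.isLinear.Build k {mpoly k[n]} V _ mnm_sum
  mnm_sum_is_linear.

Lemma mnm_sumX m : mnm_sum 'X_[m] = w m.
Proof. by rewrite /mnm_sum msuppX big_seq1 mcoeffX eqxx scale1r. Qed.

End MonomialSum.

Section Contraction.
Variables (k : fieldType) (L : fieldExtType k) (n : nat) (q : 'I_n -> L).
Implicit Types (phi : L -> k) (D A : {mpoly k[n + n]}) (g : {mpoly k[n]}).

Local Notation qm m := (peval q 'X_[m]).

(** The image of a polynomial [sum u (x) v] under [phi (x) id], in [L]: each
    monomial of [k[y] (x) k[y]] is split in its two halves, evaluated at [q]. *)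
Definition contract phi : {mpoly k[n + n]} -> L :=
  mnm_sum (fun m => phi (qm (mnm_l m)) *: qm (mnm_r m)).
HB.instance Definition _ phi := GRing.Linear.on (contract phi).

Lemma eq_contract phi psi D : phi =1 psi -> contract phi D = contract psi D.
Proof. by move=> e; congr contract; apply: funext. Qed.

Lemma contractD phi psi D :
  contract (fun x => phi x + psi x) D = contract phi D + contract psi D.
Proof.
rewrite /contract /mnm_sum -big_split; apply: eq_bigr => m _ /=.
by rewrite scalerDl scalerDr.
Qed.

Lemma contractZ c phi D :
  contract (fun x => c * phi x) D = c *: contract phi D.
Proof.
rewrite /contract /mnm_sum scaler_sumr; apply: eq_bigr => m _.
by rewrite !scalerA mulrCA mulrA.
Qed.

Lemma contract_sum (I : finType) (phi : I -> L -> k) D :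
  contract (fun x => \sum_i phi i x) D = \sum_i contract (phi i) D.
Proof.
rewrite /contract /mnm_sum exchange_big; apply: eq_bigr => m _ /=.
by rewrite scaler_suml scaler_sumr.
Qed.

Lemma functional_mul phi x : scalar phi -> scalar (fun y => phi (x * y)).
Proof. by move=> h a u v; rewrite mulrDr -scalerAr h. Qed.

Lemma functional0 phi : scalar phi -> phi 0 = 0.
Proof. by move=> h; have := h (-1) 0 0; rewrite scaler0 addr0 mulN1r addNr. Qed.

Lemma functionalZ phi c x : scalar phi -> phi (c *: x) = c * phi x.
Proof. by move=> h; have := h c x 0; rewrite functional0 // !addr0. Qed.

Lemma functionalD phi x y : scalar phi -> phi (x + y) = phi x + phi y.
Proof. by move=> h; have := h 1 x y; rewrite scale1r mul1r. Qed.

Lemma functional_sum phi (I : finType) (c : I -> k) (x : I -> L) : scalar phi ->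
  phi (\sum_i c i *: x i) = \sum_i c i * phi (x i).
Proof.
move=> h; elim/big_rec2: _ => [|i a b _ <-]; first exact: functional0.
by rewrite functionalD // functionalZ.
Qed.

Lemma mnm_lE m j : mnm_l (m + U_(lshift n j)) = (mnm_l m + U_(j))%MM.
Proof. by apply/mnmP=> i; rewrite !(mnmE, mnmDE) eq_lshift. Qed.
Lemma mnm_lR m j : mnm_l (m + U_(rshift n j)) = mnm_l m.
Proof. by apply/mnmP=> i; rewrite !(mnmE, mnmDE) eq_rlshift addn0. Qed.
Lemma mnm_rE m j : mnm_r (m + U_(rshift n j)) = (mnm_r m + U_(j))%MM.
Proof. by apply/mnmP=> i; rewrite !(mnmE, mnmDE) eq_rshift. Qed.
Lemma mnm_rL m j : mnm_r (m + U_(lshift n j)) = mnm_r m.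
Proof. by apply/mnmP=> i; rewrite !(mnmE, mnmDE) eq_lrshift addn0. Qed.

Lemma contract_tensor_l g phi A : scalar phi ->
  contract phi (A * tensor_l g) = contract (fun x => phi (peval q g * x)) A.
Proof.
elim/mpoly_ring_ind: g phi A => [c|i|g h IHg IHh|g h IHg IHh] phi A hphi.
- rewrite /tensor_l comp_mpolyC mulrC mul_mpolyC linearZ /= /contract.
  rewrite /mnm_sum scaler_sumr; apply: eq_bigr => m _; rewrite pevalC.
  by rewrite mulr_algl functionalZ // !scalerA mulrCA mulrA.
- rewrite /tensor_l comp_mpolyXU -tnth_nth tnth_mktuple pevalX.
  elim/mpolyind: A => [|c m A _ _ IH]; first by rewrite mul0r !linear0.
  rewrite mulrDl -scalerAl -mpolyXD !linearP /= IH; congr (_ *: _ + _).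
  rewrite /contract !mnm_sumX mnm_lE mnm_rL mpolyXD rmorphM /= pevalX.
  by rewrite mulrC.
- rewrite /tensor_l rmorphD mulrDr linearD /= -/(tensor_l _) IHg // -/(tensor_l
  _) IHh //.
  rewrite -contractD; apply: eq_contract => x.
  by rewrite rmorphD mulrDl functionalD.
- rewrite /tensor_l rmorphM mulrA /= -/(tensor_l _) -/(tensor_l _) IHh // IHg;
  last exact: functional_mul.
  by apply: eq_contract => x; rewrite rmorphM /= mulrA (mulrC (peval q h)).
Qed.

Lemma contract_tensor_r g phi A :
  contract phi (A * tensor_r g) = peval q g * contract phi A.
Proof.
elim/mpoly_ring_ind: g A => [c|i|g h IHg IHh|g h IHg IHh] A.
- rewrite /tensor_r comp_mpolyC mulrC mul_mpolyC linearZ /= pevalC.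
  by rewrite mulr_algl.
- rewrite /tensor_r comp_mpolyXU -tnth_nth tnth_mktuple pevalX.
  elim/mpolyind: A => [|c m A _ _ IH]; first by rewrite mul0r !linear0 mulr0.
  rewrite mulrDl -scalerAl -mpolyXD !linearP /= IH mulrDr -scalerAr;
    congr (_ *: _ + _).
  rewrite /contract !mnm_sumX mnm_lR mnm_rE mpolyXD rmorphM /= pevalX.
  by rewrite -scalerAr mulrC.
- by rewrite /tensor_r rmorphD mulrDr linearD /= -!/(tensor_r _) IHg IHh
  rmorphD mulrDl.
- rewrite /tensor_r rmorphM mulrA /= -!/(tensor_r _) IHh IHg rmorphM /= mulrA.
  by rewrite (mulrC (peval q h)).
Qed.

Variable F : 'I_n -> {mpoly k[n]}.
Hypothesis F0 : forall i, peval q (F i) = 0.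
Let D := \det (ss_coef F).

(** For a variable, the difference of both sides is the contraction of
    [D * (y_j (x) 1 - 1 (x) y_j)], a combination of the
    [F i (x) 1 - 1 (x) F i], and these contract to zero as [F] vanishes at
    [q]. *)
Lemma contract_balanced g phi : scalar phi ->
  contract (fun x => phi (peval q g * x)) D = peval q g * contract phi D.
Proof.
elim/mpoly_ring_ind: g phi => [c|i|g h IHg IHh|g h IHg IHh] phi hphi.
- rewrite pevalC mulr_algl -contractZ; apply: eq_contract => x.
  by rewrite mulr_algl functionalZ.
- apply/eqP; rewrite -subr_eq0 -contract_tensor_r -contract_tensor_l //.
  rewrite -linearB -mulrBr det_ss_coefX linear_sum big1 // => j _.
  rewrite mulrBr linearB /= contract_tensor_l // contract_tensor_r F0 mul0r
    subr0.
  rewrite /contract /mnm_sum big1 // => m _.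
  by rewrite mul0r functional0 // scale0r scaler0.
- rewrite rmorphD mulrDl -IHg // -IHh // -contractD; apply: eq_contract => x.
  by rewrite mulrDl functionalD.
- rewrite rmorphM /= -mulrA -IHh // -IHg; last exact: functional_mul.
  by apply: eq_contract => x; rewrite mulrCA mulrA.
Qed.

(** The point [(q, q)], at which evaluation is the multiplication map from
    [k[y] (x) k[y]] to [L]. *)
Definition diag_point (i : 'I_(n + n)) : L :=
  match split i with inl j => q j | inr j => q j end.

Lemma diag_lshift j : diag_point (lshift n j) = q j.
Proof. by rewrite /diag_point (unsplitK (inl j)). Qed.
Lemma diag_rshift j : diag_point (rshift n j) = q j.
Proof. by rewrite /diag_point (unsplitK (inr j)). Qed.

Lemma peval_diag_mnm m : peval diag_point 'X_[m] = qm (mnm_l m) * qm (mnm_r m).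
Proof.
rewrite /peval !mmapX /mmap1 big_split_ord.
by congr (_ * _); apply: eq_bigr => j _; rewrite ?diag_lshift ?diag_rshift mnmE.
Qed.

Lemma peval_diag A :
  peval diag_point A = \sum_(m <- msupp A) A@_m *: (qm (mnm_l m) * qm (mnm_r
    m)).
Proof.
rewrite [in LHS](mpolyE A) rmorph_sum; apply: eq_bigr => m _.
by rewrite /= pevalZ peval_diag_mnm.
Qed.

Lemma peval_diag_tensor_l g : peval diag_point (tensor_l g) = peval q g.
Proof.
rewrite peval_comp; apply: eq_peval => j.
by rewrite tnth_mktuple pevalX diag_lshift.
Qed.
Lemma peval_diag_tensor_r g : peval diag_point (tensor_r g) = peval q g.
Proof.
rewrite peval_comp; apply: eq_peval => j.
by rewrite tnth_mktuple pevalX diag_rshift.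
Qed.

Lemma mderiv_tensor_l g j : (tensor_l g)^`M(lshift n j) = tensor_l g^`M(j).
Proof.
rewrite mderiv_comp (bigD1 j) //= tnth_mktuple mderivXU eqxx mulr1 big1 ?addr0
  //.
by move=> i /negPf ij; rewrite tnth_mktuple mderivXU eq_lshift ij mulr0.
Qed.
Lemma mderiv_tensor_r g j : (tensor_r g)^`M(lshift n j) = 0.
Proof.
rewrite mderiv_comp big1 // => i _.
by rewrite tnth_mktuple mderivXU eq_rlshift mulr0.
Qed.

(** Differentiate the decomposition of [F i (x) 1 - 1 (x) F i] with respect to
    [y_j (x) 1]: on the diagonal only the term [a i j] survives. *)
Lemma peval_diag_ss_coef : map_mx (peval diag_point) (ss_coef F) = jacobian_mx
  q F.
Proof.
apply/matrixP=> i j; rewrite !mxE.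
have := congr1 (fun A => peval diag_point A^`M(lshift n j)) (ss_coefP F i).
rewrite /= mderivB mderiv_tensor_l mderiv_tensor_r subr0 peval_diag_tensor_l =>
  ->.
rewrite (linear_sum (mderiv _)) rmorph_sum (bigD1 j) //= [X in _ + X]big1 =>
  [|s sj].
  rewrite addr0 mderivM mderivB mderiv_tensor_l mderiv_tensor_r subr0 mderivXU
    eqxx.
  rewrite rmorphD !rmorphM rmorphB /= peval_diag_tensor_l peval_diag_tensor_r.
  by rewrite subrr mulr0 add0r /tensor_l rmorph1 rmorph1 mulr1.
rewrite mderivM mderivB mderiv_tensor_l mderiv_tensor_r subr0 mderivXU (negPf
  sj).
rewrite rmorphD !rmorphM rmorphB /= peval_diag_tensor_l peval_diag_tensor_r.
by rewrite subrr mulr0 add0r /tensor_l rmorph0 rmorph0 mulr0.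
Qed.

Lemma peval_diag_det : peval diag_point D = \det (jacobian_mx q F).
Proof. by rewrite -peval_diag_ss_coef det_map_mx. Qed.

End Contraction.

Section ContractTrace.
Variables (k : fieldType) (L : fieldExtType k) (n : nat) (q : 'I_n -> L).
Variable F : 'I_n -> {mpoly k[n]}.
Hypothesis F0 : forall i, peval q (F i) = 0.
Implicit Types (phi : L -> k).
Let D := \det (ss_coef F).
Local Notation qm m := (peval q 'X_[m]).
Local Notation contract := (contract q).
Hypothesis q_gen : forall x, exists g, peval q g = x.

Lemma contract_mul x phi : scalar phi ->
  contract (fun y => phi (x * y)) D = x * contract phi D.
Proof. by have [g <-] := q_gen x; apply: contract_balanced. Qed.

Local Notation e := (vbasis {:L}).

Lemma coord_is_scalar (i : 'I_(\dim {:L})) : scalar (coord e i).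
Proof. by move=> a x y; rewrite linearP. Qed.

(** [Tr(x) = sum_i e_i^*(e_i x)] for a basis [e] with coordinates [e_i^*].
    Balancing moves [e_i] to the second factor, and
    [sum_i e_i^*(u) e_i v = u v] leaves the value of [D] on the diagonal. *)
Lemma contract_trace : contract (field_trace (L := L)) D = \det (jacobian_mx q
  F).
Proof.
transitivity (\sum_(i < \dim {:L}) e`_i * contract (coord e i) D).
  transitivity (\sum_(i < \dim {:L}) contract (fun y => coord e i (e`_i * y))
    D).
    rewrite -contract_sum; apply: eq_contract => x.
    by apply: eq_bigr => i _; rewrite mulrC.
  by apply: eq_bigr => i _; apply: contract_mul; apply: coord_is_scalar.
rewrite -peval_diag_det peval_diag /contract /mnm_sum.
under eq_bigr do rewrite mulr_sumr.
rewrite exchange_big; apply: eq_bigr => m _ /=.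
rewrite [in RHS](coord_vbasis (memvf (qm (mnm_l m)))) mulr_suml scaler_sumr.
by apply: eq_bigr => i _; rewrite -!scalerAr -scalerAl.
Qed.

(** Here [Tr(c v) = sum_i e_i^*(c e_i v)], balancing moves [e_i] to the first
    factor, inside [phi], and [sum_i e_i^*(c v) e_i u = c u v]. *)
Lemma trace_contract c phi : scalar phi ->
  field_trace (c * contract phi D) = phi (c * \det (jacobian_mx q F)).
Proof.
move=> hphi; rewrite /field_trace.
transitivity (\sum_(i < \dim {:L}) coord e i (c * contract (fun y => phi (e`_i
  * y)) D)).
  by apply: eq_bigr => i _; rewrite contract_mul // mulrAC mulrA.
rewrite -peval_diag_det peval_diag mulr_sumr.
under eq_bigr => i _ do rewrite /contract /mnm_sum mulr_sumr linear_sum.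
rewrite exchange_big /=.
have phi_sum (s : seq 'X_{1..n + n}) (f : _ -> L) :
    phi (\sum_(m <- s) f m) = \sum_(m <- s) phi (f m).
  elim/big_rec2: _ => [|m a b _ <-]; first exact: functional0.
  by rewrite functionalD.
rewrite phi_sum; apply: eq_bigr => m _.
rewrite -[in RHS]scalerAr functionalZ // mulrCA.
rewrite [c * _](coord_vbasis (memvf (c * qm (mnm_r m)))) mulr_sumr.
under [X in phi X]eq_bigr => i _ do rewrite -scalerAr.
rewrite functional_sum // mulr_sumr; apply: eq_bigr => i _.
by rewrite -!scalerAr !linearZ /= (mulrC (qm _)) [in RHS](mulrC (coord _ _ _)).
Qed.

End ContractTrace.

(** * The local degree at a simple zero *)

Section LocalDegreeAtSimpleZero.
Variables (k : fieldType) (L : fieldExtType k) (n : nat) (q : 'I_n -> L).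
Variable F : 'I_n -> {mpoly k[n]}.
Hypothesis F0 : forall i, peval q (F i) = 0.
Hypothesis J0 : \det (jacobian_mx q F) != 0.
Hypothesis q_gen : forall x, exists g, peval q g = x.
Local Notation Q := (local_alg q F).
Local Notation J := (\det (jacobian_mx q F)).
Local Notation h := (from_residue F q_gen).

Lemma from_residue1 : h 1 = 1.
Proof. by rewrite -(rmorph1 (peval q)) from_residueE // rmorph1. Qed.

Lemma ss_mapE D (phi : Q -> k) : ss_map D phi = h (contract q (phi \o h) D).
Proof.
rewrite /contract /mnm_sum linear_sum; apply: eq_bigr => m _.
by rewrite !linearZ /= !from_residueE // scalerA.
Qed.

Lemma scalar_comp_from_residue (phi : Q -> k) : scalar phi -> scalar (phi \o h).
Proof. by move=> hphi a x y; rewrite /= linearP hphi. Qed.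

Lemma trace_div_is_scalar : scalar (fun x : L => field_trace (J^-1 * x)).
Proof. exact: functional_mul (@field_trace_is_scalar _ _). Qed.

(** The functional is [x |-> Tr(x / J)], by [contract_trace]. *)
Lemma theta_trace :
  exists phi : Q -> k, scalar phi /\ ss_theta phi = 1.
Proof.
have [hi hiK Khi] := from_residue_bij F0 J0 q_gen.
have hi_lin : linear hi.
  by move=> a u v; apply: (can_inj hiK); rewrite linearP /= !Khi.
exists (fun u => field_trace (J^-1 * hi u)); split.
  by move=> a u v; rewrite hi_lin trace_div_is_scalar.
rewrite /ss_theta ss_mapE -from_residue1; congr (h _).
rewrite (_ : contract _ _ _ = contract q (fun x => field_trace (J^-1 * x))
  (\det (ss_coef F))).
  rewrite contract_mul //; last exact: field_trace_is_scalar.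
  by rewrite contract_trace // mulVf.
by apply: eq_contract => x; rewrite /= hiK.
Qed.

Lemma ss_etaP : scalar (@ss_eta _ _ _ q F) /\ ss_theta (@ss_eta _ _ _ q F) = 1.
Proof.
rewrite /ss_eta; case: xgetP => // no.
by have [phi phiP] := theta_trace; case: (no phi).
Qed.

(** The functional [ss_eta] is only known through [Theta(ss_eta) = 1];
    [trace_contract] shows that this determines it. *)
Lemma ss_eta_from_residue x : ss_eta (h x) = field_trace (x / J).
Proof.
have [es et] := ss_etaP; have hs := scalar_comp_from_residue es.
have e1 : contract q (@ss_eta _ _ _ q F \o h) (\det (ss_coef F)) = 1.
  apply: (bij_inj (from_residue_bij F0 J0 q_gen)).
  by rewrite -ss_mapE from_residue1.
have := trace_contract F0 q_gen (x / J) hs.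
by rewrite e1 mulr1 divfK.
Qed.

Lemma ss_form_bilinear : is_bilinear (@ss_form _ _ _ q F).
Proof.
have [es _] := ss_etaP; rewrite /ss_form; split=> u a v w /=.
  by rewrite mulrDr -es; congr (ss_eta (_ + _));
    rewrite /GRing.scale /= /la_scale mulrCA.
by rewrite mulrDl -es; congr (ss_eta (_ + _));
  rewrite /GRing.scale /= /la_scale mulrA.
Qed.

(** Otherwise the contraction with the trace, which is [J], would vanish. *)
Lemma field_trace_neq0 : exists x : L, field_trace x != 0.
Proof.
apply: contrapT => no; case/eqP: J0; rewrite -contract_trace // /contract.
have t0 x : field_trace (x : L) = 0.
  by apply/eqP/negPn/negP => tx; apply: no; exists x.
by rewrite /mnm_sum big1 // => m _; rewrite t0 scale0r scaler0.
Qed.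

Lemma scalar_nondeg (a : L) : a != 0 -> nondeg_sym (a%:M : 'M[L]_1).
Proof. by move=> a0; rewrite /nondeg_sym tr_scalar_mx eqxx unitmxE det_scalar1
  unitfE. Qed.

Lemma gw_unitE (a : L) (a0 : a != 0) :
  gw_unit a = gc_inj (\pi_(form_class L)%qT (SymForm (scalar_nondeg a0))).
Proof.
congr gc_inj; apply: form_class_ofE.
  split=> u c x y /=; rewrite /GRing.scale /=; first by rewrite mulrDr mulrCA.
  by rewrite mulrDr mulrDl mulrCA !mulrA.
exists (fun=> 1) => [|i j].
  exists (fun x : L^o => x%:M) => [c|x]; rewrite /lincomb big_ord1.
    by apply/rowP=> i; rewrite !ord1 mxE eqxx mulr1n /GRing.scale /= mulr1.
  by rewrite mxE eqxx mulr1n /GRing.scale /= mulr1.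
by rewrite /form_mx /= !mulr1 mxE !ord1 eqxx.
Qed.

(** The isometry [u |-> J u] carries [(x, y) |-> Tr(J x y)] to
    [(x, y) |-> Tr(x y / J)]. *)
Theorem local_degree_simple_zero : local_degree q F = gw_trace (gw_unit J).
Proof.
rewrite gw_unitE gw_traceE; set f := SymForm _.
have [g rg] := trace_form_represents f field_trace_neq0.
congr gc_inj; rewrite (form_class_ofE (trace_form_bilinear f) rg).
apply: form_class_ofE ss_form_bilinear _.
have [hi hiK Khi] := from_residue_bij F0 J0 q_gen.
apply: (@represents_iso _ _ _ _ _ (fun u : {ffun 'I_1 -> L} => h (J * u 0))) rg.
- by move=> a u v; rewrite !ffunE mulrDr -scalerAr linearP.
- exists (fun w => [ffun=> J^-1 * hi w]) => [u|w].
    by apply/ffunP=> i; rewrite ffunE hiK mulKf // !ord1.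
  by rewrite ffunE mulVKf.
move=> u v; rewrite /ss_form -from_residueM // ss_eta_from_residue /trace_form.
congr field_trace; rewrite /form_mx /= mul_mx_scalar -scalemxAl !mxE big_ord1
  !mxE.
by rewrite mulrCA mulrAC mulfV // mul1r mulrA.
Qed.

End LocalDegreeAtSimpleZero.

(** * Transversality and the Jacobian in a chart *)

Section Chart.
Variables (k : fieldType) (n : nat) (p : closed_point k n) (l : 'I_n.+1).
Hypothesis xl0 : hcoord p l != 0.
Implicit Types g : {mpoly k[n.+1]}.
Local Notation x := (hcoord p).
Local Notation q := (chart_coord l p).

Lemma chart_signC (i : 'I_n.+1) :
  chart_sign {mpoly k[n]} l i = (chart_sign k l i)%:MP.
Proof.
by rewrite /chart_sign; case: ifP => _; rewrite ?rmorph1 // rmorphXn rmorphN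
  rmorph1.
Qed.

Lemma chart_sign_alg (i : 'I_n.+1) :
  (chart_sign k l i)%:A = chart_sign (residue_field p) l i.
Proof.
by rewrite /chart_sign; case: ifP => _; rewrite -in_algE ?rmorph1 // rmorphXn
  rmorphN rmorph1.
Qed.

Lemma chart_sign_sqr (S : pzRingType) (i : 'I_n.+1) :
  chart_sign S l i * chart_sign S l i = 1.
Proof. by rewrite /chart_sign; case: ifP => _;
  rewrite ?mulr1 // -expr2 sqrr_sign. Qed.

(** The sign in the coordinates of the chart cancels the sign in the
    substitution. *)
Lemma peval_chart_subst g :
  peval q (g \mPo chart_subst k l) = peval (fun i => (x l)^-1 * x i) g.
Proof.
rewrite peval_comp; apply: eq_peval => i; rewrite tnth_mktuple.
case: unliftP => [j|] ->; last by rewrite rmorph1 mulVf.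
rewrite chart_signC rmorphM /= pevalC pevalX chart_sign_alg /chart_coord.
by rewrite mulrA chart_sign_sqr mul1r mulrC.
Qed.

Lemma peval_chart_expr d g : g \is d.-homog ->
  peval q (chart_expr l g) = (x l)^-1 ^+ d * value_at p g.
Proof. by move=> gd; rewrite peval_chart_subst (peval_homog _ _ gd). Qed.

Lemma peval_mderiv_chart_expr d g j : g \is d.-homog ->
  peval q (chart_expr l g)^`M(j)
    = (x l)^-1 ^+ d.-1 *
      (chart_sign _ l (lift l j) * value_at p g^`M(lift l j)).
Proof.
move=> gd; rewrite /chart_expr mderiv_comp (bigD1 (lift l j)) //= big1 ?addr0.
  rewrite tnth_mktuple liftK chart_signC mderiv_mulC mderivXU eqxx mulr1.
  rewrite rmorphM /= pevalC chart_sign_alg peval_chart_subst.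
  by rewrite (peval_homog _ _ (mderiv_homog _ gd)) mulrCA mulrC mulrA.
move=> i; rewrite tnth_mktuple; case: unliftP => [s|] -> ij.
  have sj : (s == j) = false by apply: contraNF ij => /eqP ->.
  by rewrite chart_signC mderiv_mulC mderivXU sj !mulr0.
by rewrite -mpolyC1 mderivC mulr0.
Qed.

Lemma chart_coord_gen y : exists h, peval q h = y.
Proof.
have [g <-] : exists g, peval (fun i => (x l)^-1 * x i) g = y.
  apply: (@adjoin_peval _ _ _ _ [seq x i / x l | i <- enum 'I_n.+1]).
    by move=> z /mapP[i _ ->]; exists 'X_i; rewrite pevalX mulrC.
  by rewrite (hcoord_gen xl0) memvf.
by exists (g \mPo chart_subst k l); rewrite peval_chart_subst.
Qed.

End Chart.

Section Transversality.
Variables (k : fieldType) (n : nat) (p : closed_point k n).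
Local Notation v := (coord_row p).

Lemma coord_row_neq0 : v != 0.
Proof. by have [i xi] := hcoord_neq0 p; apply/rV0Pn; exists i; rewrite mxE. Qed.

(** The kernel of the gradient has rank [n] and contains the line of
    homogeneous coordinates, by Euler's identity; the image modulo this line
    has rank at most [n - 1]. *)
Lemma codim_tangent_gt0 g :
    hypersurface g -> lies_on p g -> smooth_at p g ->
  (0 < codim (tangent p g))%N.
Proof.
move=> [_ [d _ gd]] g0 gs; rewrite /codim rank_tangent_Pn subn_gt0.
have vk : (v <= kermx (gradient_at p g))%MS.
  apply/sub_kermxP/rowP => i; rewrite !mxE.
  under eq_bigr do rewrite !mxE.
  by rewrite (euler_homog (hcoord p) gd) -/(value_at p g) g0 mulr0.
have vc : (v <= kermx (cokermx v))%MS by apply/sub_kermxP/mulmx_coker.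
have := mxrank_mul_ker (kermx (gradient_at p g)) (cokermx v).
rewrite mxrank_ker -[gradient_at p g]trmxK mxrank_tr rank_rV trmxK.
have -> : (gradient_at p g)^T != 0 by rewrite trmx_eq0.
rewrite subSS subn0 -/(tangent p g) => rE.
suff : (\rank (tangent p g) < \rank (tangent p g)
          + \rank (kermx (gradient_at p g) :&: kermx (cokermx v)))%N by rewrite
            rE.
rewrite -[X in (X < _)%N]addn0 ltn_add2l.
apply: (@leq_trans (\rank v)); first by rewrite rank_rV coord_row_neq0.
by apply: mxrankS; rewrite sub_capmx vk.
Qed.

(** The codimension of the intersection is at least [n], the dimension of the
    whole tangent space, so that the intersection of the tangent spaces is
    zero. *)
Lemma transverse_kernel f (w : 'rV_n.+1) : (0 < n)%N ->
    (forall i, hypersurface (f i)) -> transverse_at p f ->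
    (forall i : 'I_n, w *m gradient_at p (f i) = 0) ->
  exists a, w = a *: v.
Proof.
move=> n0 hf [fp fs ft] wf.
have r0 : (\bigcap_i tangent p (f i))%MS = 0.
  apply/eqP; rewrite -mxrank_eq0.
  have : (n <= codim (\bigcap_i tangent p (f i))%MS)%N.
    rewrite ft -[n in X in (X <= _)%N]card_ord -sum1_card;
      apply: leq_sum => i _.
    exact: codim_tangent_gt0.
  by rewrite /codim rank_tangent_Pn; case: (\rank _) => // r;
    rewrite leqNgt ltn_subrL n0.
apply/sub_rVP; rewrite submxE -submx0 -r0; apply/sub_bigcapmxP => i _.
by apply: submxMr; apply/sub_kermxP.
Qed.

(** A vector [u] killed by the Jacobian matrix in the chart becomes, with a zero
    inserted at place [l] and up to signs, a vector [w] killed by all the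
    gradients.  So [w] is proportional to the homogeneous coordinates, whose
    [l]-th entry is nonzero while that of [w] is zero. *)
Lemma transverse_det_jacobian_neq0 f l : (0 < n)%N -> hcoord p l != 0 ->
    (forall i, hypersurface (f i)) -> transverse_at p f ->
  \det (jacobian_mx (chart_coord l p) (fun i => chart_expr l (f i))) != 0.
Proof.
move=> n0 xl0 hf ft; rewrite -det_tr; apply/negP => /det0P[u u0 uJ].
pose s j := chart_sign (residue_field p) l (lift l j).
pose w : 'rV[residue_field p]_n.+1 :=
  \row_i if unlift l i is Some j then s j * u 0 j else 0.
have [i|a wa] := @transverse_kernel f w n0 hf ft.
  apply/rowP => z; rewrite mxE [RHS]mxE (bigD1_ord l) //= mxE unlift_none mul0r
    add0r.
  have [_ [d _ gd]] := hf i.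
  have := congr1 (fun A : 'rV__ => (hcoord p l) ^+ d.-1 * A 0 i) uJ.
  rewrite !mxE mulr0 mulr_sumr => uJi; rewrite -[RHS]uJi; apply: eq_bigr => j _.
  rewrite !mxE liftK (peval_mderiv_chart_expr xl0 _ gd).
  rewrite mulrCA [X in _ = _ * X]mulrA -exprMn mulfV // expr1n mul1r.
  by rewrite mulrCA mulrA.
have a0 : a = 0.
  have := congr1 (fun A : 'rV__ => A 0 l) wa; rewrite !mxE unlift_none.
  by move=> /esym/eqP; rewrite mulf_eq0 (negPf xl0) orbF => /eqP.
case/negP: u0; apply/eqP/rowP => j; rewrite mxE.
have := congr1 (fun A : 'rV__ => s j * A 0 (lift l j)) wa.
by rewrite a0 scale0r !mxE liftK mulrA chart_sign_sqr mul1r mulr0.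
Qed.

End Transversality.

Theorem lemma5p5 (k : fieldType) (n : nat)
    (f : 'I_n -> {mpoly k[n.+1]}) (p : closed_point k n) (l : 'I_n.+1)
    (perfect_k : perfect_field k) (n_gt0 : (0 < n)%N)
    (hypersurface_f : forall i, hypersurface (f i))
    (p_in_chart : in_chart p l)
    (transverse_f : transverse_at p f) :
  section_degree l f p
    = gw_trace (gw_unit (peval (chart_coord l p) (jacobian l f))).
Proof.
rewrite /jacobian -det_jacobian_mx; apply: local_degree_simple_zero.
- move=> i; have [_ [d _ fd]] := hypersurface_f i;
  have [fp _ _] := transverse_f.
  by rewrite (peval_chart_expr p_in_chart fd) fp mulr0.
- exact: transverse_det_jacobian_neq0.
- exact: chart_coord_gen.
Qed.
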